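(* Suppose $T$ is a complete monadically NIP theory with monster model $\mathfrak C$, and $(I,\le)$ is a linear order without endpoints. Suppose $(\bar a_i:i\in I)$ is indiscernible and $b\in\mathfrak C$ is a singleton such that $(\bar a_i:i\in I)$ is not indiscernible over $b$. Then one of the following holds. (1) There is a cut $I=I_0+I_1$ such that $(\bar a_i:i\in I_0)$ and $(\bar a_i:i\in I_1)$ are mutually indiscernible over $b$. Furthermore, in this case the cut is unique, and $i^*\in I$ is such that $(\bar a_i:i<i^* )$ and $(\bar a_i:i>i^* )$ are mutually indiscernible over $b$ if and only if $i^*$ is either the maximal element of $I_0$ or the minimal element of $I_1$. (2) There is a unique $i^*\in I$ such that $(\bar a_i:i<i^* )$ and $(\bar a_i:i>i^* )$ are mutually indiscernible over $b$. Furthermore, in this case they are mutually indiscernible over $\bar a_{i^*}b$.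
   Context: A theory $T$ is monadically NIP if for every $M\models T$ and every expansion $M^+$ of $M$ by unary predicates, $Th(M^+)$ is NIP. Indiscernible sequences are infinite sequences of tuples of the same length in $\mathfrak C$. Two sequences are mutually indiscernible over a set $B$ if each is indiscernible over $B$ together with all elements of the other. A cut $I=I_0+I_1$ (where $+$ denotes concatenation of linear orders) is a partition of $I$ into a nonempty initial segment $I_0$ and a nonempty final segment $I_1$. *)

(* Defs.v *)
From mathcomp Require Import all_boot all_order.
From mathcomp Require Import boolp classical_sets functions cardinality.

Set Implicit Arguments.
Unset Strict Implicit.
Unset Printing Implicit Defensive.

Local Open Scope classical_set_scope.
Local Open Scope card_scope.

Record language := Language {
  fsym : Type;
  farity : fsym -> nat;
  rsym : Type;
  rarity : rsym -> nat }.

Record structure (L : language) := Structure {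
  dom :> Type;
  dom_inhabited : inhabited dom;
  finterp : forall f : fsym L, ('I_(farity f) -> dom) -> dom;
  rinterp : forall r : rsym L, ('I_(rarity r) -> dom) -> Prop }.

(* [term L V] and [formula L V] have their free variables in the type [V];
   a quantifier binds the variable [None] of a formula over [option V]. *)
Inductive term (L : language) (V : Type) : Type :=
| TVar of V
| TApp (f : fsym L) of ('I_(farity f) -> term L V).

Inductive formula (L : language) (V : Type) : Type :=
| FFalse
| FEq of term L V & term L V
| FRel (r : rsym L) of ('I_(rarity r) -> term L V)
| FImp of formula L V & formula L V
| FAll of formula L (option V).

Arguments FFalse {L V}.

Fixpoint teval L (M : structure L) V (v : V -> M) (t : term L V) : M :=
  match t with
  | TVar x => v x
  | TApp f ts => finterp (fun k => teval v (ts k))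
  end.

Definition scons (M V : Type) (c : M) (v : V -> M) (x : option V) : M :=
  if x is Some y then v y else c.

Fixpoint sat L (M : structure L) V (v : V -> M) (phi : formula L V) : Prop :=
  match phi with
  | FFalse => False
  | FEq t u => teval v t = teval v u
  | FRel r ts => rinterp (fun k => teval v (ts k))
  | FImp p q => sat v p -> sat v q
  | FAll p => forall c : M, sat (scons c v) p
  end.

Definition sentence (L : language) := formula L void.
Definition theory (L : language) := set (sentence L).

Definition holds L (M : structure L) (s : sentence L) : Prop :=
  sat (fun x : void => match x return M with end) s.

Definition model L (M : structure L) (T : theory L) : Prop :=
  forall s, T s -> holds M s.

Definition entails L (T : theory L) (s : sentence L) : Prop :=
  forall M : structure L, model M T -> holds M s.

Definition complete L (T : theory L) : Prop :=
  (exists M : structure L, model M T) /\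
  (forall s, entails T s \/ entails T (FImp s FFalse)).

Definition Th L (M : structure L) : theory L := [set s | holds M s].

Definition join (M X Y : Type) (v : X -> M) (e : Y -> M) (z : X + Y) : M :=
  match z with inl x => v x | inr y => e y end.

(* Shelah's definition of the independence property of phi(x; y) in T,
   with |x| = p and |y| = q *)
Definition has_IP L (T : theory L) p q (phi : formula L ('I_p + 'I_q)) : Prop :=
  forall n : nat, exists2 M : structure L, model M T &
    exists (a : 'I_n -> 'I_p -> M) (b : {set 'I_n} -> 'I_q -> M),
      forall i S, sat (join (a i) (b S)) phi <-> i \in S.

Definition NIP L (T : theory L) : Prop :=
  forall p q (phi : formula L ('I_p + 'I_q)), ~ has_IP T phi.

Definition unary_language (L : language) (P : Type) : language :=
  {| fsym := fsym L;
     farity := @farity L;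
     rsym := rsym L + P;
     rarity := fun r => match r with inl r => rarity r | inr _ => 1 end |}.

Definition unary_expansion L (M : structure L) P (U : P -> set M) :
    structure (unary_language L P) :=
  @Structure (unary_language L P) M (dom_inhabited M) (@finterp L M)
    (fun r => match r return ('I_(@rarity (unary_language L P) r) -> M) -> Prop
              with
              | inl r => fun xs => rinterp (r := r) xs
              | inr p => fun xs => U p (xs ord0)
              end).

Definition monadically_NIP L (T : theory L) : Prop :=
  forall M : structure L, model M T ->
  forall (P : Type) (U : P -> set M), NIP (Th (unary_expansion U)).

(* The cardinal kappa bounding the small sets is represented by a type [K] of
   that cardinality: [small K X] says |X| < kappa. *)
Definition small (K X : Type) : Prop :=
  [set: X] #<= [set: K] /\ ~ ([set: K] #<= [set: X]).

(* The types realized are the small ones in the sense of monster models: [p] may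
   be partial, and its tuple of variables may have any small length. *)
Definition saturated (K : Type) L (M : structure L) : Prop :=
  forall X Y : Type, small K X -> small K Y ->
  forall (e : Y -> M) (p : set (formula L (X + Y))),
    (forall F, finite_set F -> F `<=` p ->
       exists v : X -> M, forall phi, F phi -> sat (join v e) phi) ->
    exists v : X -> M, forall phi, p phi -> sat (join v e) phi.

Record automorphism L (M : structure L) (h : M -> M) : Prop := {
  aut_bij : bijective h;
  aut_fun : forall (f : fsym L) xs, h (finterp xs) = finterp (f := f) (h \o xs);
  aut_rel : forall (r : rsym L) (xs : 'I_(rarity r) -> M),
    rinterp (h \o xs) <-> rinterp xs }.

Definition strongly_homogeneous (K : Type) L (M : structure L) : Prop :=
  forall X : Type, small K X -> forall f g : X -> M,
    (forall phi : formula L X, sat f phi <-> sat g phi) ->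
    exists2 h : M -> M, automorphism h & h \o f = g.

(* [small K (formula L nat)] says that |T| = |L| + aleph_0 < kappa; in
   particular kappa is uncountable. *)
Definition monster_model (K : Type) L (T : theory L) (M : structure L) : Prop :=
  [/\ model M T, small K (formula L nat), saturated K M
    & strongly_homogeneous K M].

Section Sequences.
Context {L : language} {M : structure L} {A : Type}
        {d : Order.disp_t} {I : orderType d}.
Implicit Types (a : I -> A -> M) (J : set I) (B : set M).

Definition increasing n (s : 'I_n -> I) : Prop :=
  forall k l : 'I_n, (k < l)%N -> (s k < s l)%O.

(* The tuples [a i] are indexed by [A], which may be infinite.  The sequence
   concerned is the restriction (a_i : i in J), with the order induced by I. *)
Definition indiscernible a J B : Prop :=
  forall n m (phi : formula L ('I_n * A + 'I_m)) (e : 'I_m -> M),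
    (forall k, B (e k)) ->
  forall s t : 'I_n -> I,
    increasing s -> increasing t -> (forall k, J (s k)) -> (forall k, J (t k)) ->
    sat (join (fun x => a (s x.1) x.2) e) phi <->
    sat (join (fun x => a (t x.1) x.2) e) phi.

Definition entries a J : set M := [set c | exists2 i, J i & exists x, a i x = c].

Definition mutually_indiscernible a J0 J1 B : Prop :=
  indiscernible a J0 (B `|` entries a J1) /\
  indiscernible a J1 (B `|` entries a J0).

End Sequences.

Section Orders.
Context {d : Order.disp_t} {I : orderType d}.
Implicit Types (J : set I) (i : I).

Definition without_endpoints : Prop :=
  forall i, (exists j, (j < i)%O) /\ (exists j, (i < j)%O).

Definition cut J0 J1 : Prop :=
  [/\ J0 !=set0, J1 !=set0, J0 `|` J1 = [set: I]
    & forall i j, J0 i -> J1 j -> (i < j)%O].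

Definition is_maximal J i : Prop := J i /\ forall j, J j -> (j <= i)%O.
Definition is_minimal J i : Prop := J i /\ forall j, J j -> (i <= j)%O.

Definition below i : set I := [set j | (j < i)%O].
Definition above i : set I := [set j | (i < j)%O].

End Orders.

Arguments without_endpoints {d} I.

(* Main.v *)
Require Import Defs.
From mathcomp Require Import all_boot all_order.
From mathcomp Require Import boolp classical_sets functions cardinality.

(** Call an interval [p, q] of I a break if moving a single index of a tuple from
    p to q, the other indices lying outside of [p, q], changes the truth value of
    a formula over b.  A break can be split at each interior point, and mutual
    indiscernibility over b amounts to the absence of breaks, so the proposition
    reduces to order theory once any two breaks are known to intersect.

    If [p, q] lies to the left of another break [p', q'], replicate the part of
    the tuple within [p, q] as x_0 < x_1 < ..., and the part within [p', q'] as
    y_0 < y_1 < ...: there are singletons c_{s,t} that break at x_s and at y_t.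
    By NIP a given singleton breaks few cells in each row and in each column of
    the grid, hence exactly one cell of a suitable subgrid, and indiscernibility
    moves this subgrid to any other one.  So Q(x_s, y_t, c_{u,v}) holds iff
    (s, t) = (u, v) for some formula Q, and a unary predicate naming the c_{s,t}
    with (s, t) in E then defines an arbitrary bipartite graph E. *)

Set Implicit Arguments.
Unset Strict Implicit.
Unset Printing Implicit Defensive.

Import Order.TTheory.
Local Open Scope classical_set_scope.
Local Open Scope card_scope.

(** * Definable relations and coding by unary predicates *)

Fixpoint tren (L : language) (V W : Type) (f : V -> W) (t : term L V) :
    term L W :=
  match t with
  | TVar x => @TVar L W (f x)
  | TApp g ts => @TApp L W g (fun k => tren f (ts k))
  end.

Fixpoint fren (L : language) (V W : Type) (f : V -> W) (phi : formula L V) :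
    formula L W :=
  match phi with
  | FFalse => FFalse
  | FEq t u => FEq (tren f t) (tren f u)
  | FRel r ts => @FRel L W r (fun k => tren f (ts k))
  | FImp p q => FImp (fren f p) (fren f q)
  | FAll p => FAll (fren (omap f) p)
  end.

Lemma teval_ren (L : language) (M : structure L) (V W : Type) (f : V -> W)
    (v : W -> M) (t : term L V) : teval v (tren f t) = teval (v \o f) t.
Proof. by elim: t => //= g ts IH; congr finterp; apply: funext. Qed.

Lemma scons_omap (M V W : Type) (f : V -> W) (v : W -> M) (c : M) :
  scons c v \o omap f = scons c (v \o f).
Proof. by apply: funext => -[]. Qed.

Lemma sat_ren (L : language) (M : structure L) (V : Type)
    (phi : formula L V) :
  forall (W : Type) (f : V -> W) (v : W -> M),
  sat v (fren f phi) = sat (v \o f) phi.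
Proof.
elim: phi => {V} [V|V t u|V r ts|V p IHp q IHq|V p IHp] W f v //=.
- by rewrite !teval_ren.
- by congr rinterp; apply: funext => k; rewrite teval_ren.
- by rewrite IHp IHq.
- by apply: eq_forall => c; rewrite IHp scons_omap.
Qed.

(** * Finite supports of terms and formulas *)

Section Support.
Variables (L : language).

Lemma teval_support (V : Type) (t : term L V) :
  exists2 S : set V, finite_set S &
    forall (M : structure L) (v w : V -> M),
      (forall x, S x -> v x = w x) -> teval v t = teval w t.
Proof.
elim: t => [x|f ts IH] /=.
  by exists [set x] => [|M v w ->//]; exact: finite_set1.
have /choice[S SP] k : exists S : set V, finite_set S /\
    forall (M : structure L) (v w : V -> M),
      (forall x, S x -> v x = w x) -> teval v (ts k) = teval w (ts k).
  by have [S fS SP] := IH k; exists S.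
exists (\bigcup_(k in setT) S k).
  by apply: bigcup_finite => [|k _]; [exact: finite_finset | case: (SP k)].
move=> M v w vw; congr finterp; apply: funext => k.
by apply: (SP k).2 => x Sx; apply: vw; exists k.
Qed.

(** The index type [A] of the tuples may be infinite, whereas NIP speaks of finite tuples; finite
    supports bridge the gap. *)
Lemma sat_support (V : Type) (phi : formula L V) :
  exists2 S : set V, finite_set S &
    forall (M : structure L) (v w : V -> M),
      (forall x, S x -> v x = w x) -> sat v phi = sat w phi.
Proof.
elim: phi => {V} [V|V t u|V r ts|V p [S fS SP] q [S' fS' SP']|V p [S fS SP]].
- by exists set0.
- have [S fS SP] := teval_support t; have [S' fS' SP'] := teval_support u.
  exists (S `|` S') => [|M v w vw /=]; first by rewrite finite_setU.
  by rewrite (SP M v w) ?(SP' M v w)// => x Sx; apply: vw; [right|left].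
- have /choice[S SP] k : exists S : set V, finite_set S /\
      forall (M : structure L) (v w : V -> M),
        (forall x, S x -> v x = w x) -> teval v (ts k) = teval w (ts k).
    by have [S fS SP] := teval_support (ts k); exists S.
  exists (\bigcup_(k in setT) S k).
    by apply: bigcup_finite => [|k _]; [exact: finite_finset | case: (SP k)].
  move=> M v w vw /=; congr rinterp; apply: funext => k.
  by apply: (SP k).2 => x Sx; apply: vw; exists k.
- exists (S `|` S') => [|M v w vw /=]; first by rewrite finite_setU.
  by rewrite (SP M v w) ?(SP' M v w)// => x Sx; apply: vw; [right|left].
(* The bound variable [None] leaves the support: both valuations give it the value [c]. *)
- exists (Some @^-1` S).
    by apply: finite_preimage => // x y _ _ [].
  move=> M v w vw /=; apply: eq_forall => c.
  by apply: SP => -[x|] // /vw.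
Qed.

End Support.

Lemma finite_set_code (V : Type) (S : set V) : finite_set S ->
  exists n (g : V -> 'I_n) (f : 'I_n -> V), forall x, S x -> f (g x) = x.
Proof.
case: (pselect (inhabited V)) => [[x0]|V0] [n /card_set_bijP[h [hS hinj _]]].
  (* The successor makes [inord] available; codes of no element of [S] are decoded to the default
     [x0]. *)
  exists n.+1, (fun x => inord (h x)).
  exists (fun k => if pselect (exists x, S x /\ inord (h x) = k) is left e
                   then projT1 (cid e) else x0) => x Sx.
  case: pselect => [e|[]]; last by exists x.
  case: (cid e) => y [Sy /= e']; apply: hinj; rewrite ?inE//.
  have hlt z : S z -> (h z < n.+1)%N by move=> /hS; exact: leqW.
  by move: e' => /(congr1 val); rewrite /= !inordK ?hlt.
have abs T (x : V) : T by case: V0.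
exists 0, (abs _), (fun k : 'I_0 => match notF (ltn_ord k) with end) => x.
exact: abs.
Qed.

Section Definable.
Variables (L : language) (M : structure L).

(** Parameters enter as extra coordinates of the valuation. The equality is one of propositions, so
    that it can be used for rewriting. *)
Definition definable (V : Type) (R : set (V -> M)) : Prop :=
  exists phi : formula L V, forall v, R v = sat v phi.

Lemma definable_ren (V W : Type) (f : V -> W) (R : set (V -> M)) :
  definable R -> definable (fun v => R (v \o f)).
Proof. by case=> p pP; exists (fren f p) => v; rewrite pP sat_ren. Qed.

Lemma definable_not (V : Type) (R : set (V -> M)) :
  definable R -> definable (fun v => ~ R v).
Proof. by case=> p pP; exists (FImp p FFalse) => v /=; rewrite pP. Qed.

Lemma definable_imp (V : Type) (R S : set (V -> M)) :
  definable R -> definable S -> definable (fun v => R v -> S v).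
Proof. by move=> [p pP] [q qP]; exists (FImp p q) => v /=; rewrite pP qP. Qed.

Lemma definable_and (V : Type) (R S : set (V -> M)) :
  definable R -> definable S -> definable (fun v => R v /\ S v).
Proof.
move=> dR dS; have [p pP] := definable_not (definable_imp dR (definable_not dS)).
exists p => v; rewrite -pP; apply: propext; split=> [[Rv Sv] /(_ Rv)//|h].
by apply: contrapT => k; apply: h => Rv Sv; apply: k.
Qed.

Lemma definable_iff_bool (V : Type) (R : set (V -> M)) (c : bool) :
  definable R -> definable (fun v => R v <-> c).
Proof.
case: c => [[p pP]|/definable_not[p pP]]; exists p => v; rewrite -pP.
- by apply: propext; split=> [[_]|Rv]; [exact|].
- by apply: propext; split=> [[h _] /h//|nR]; split.
Qed.

Lemma definable_forall_fin (T : finType) (V : Type) (R : T -> set (V -> M)) :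
  (forall t, definable (R t)) -> definable (fun v => forall t, R t v).
Proof.
move=> dR.
suff H (s : seq T) : definable (fun v => forall t, t \in s -> R t v).
  have [p pP] := H (enum T); exists p => v; rewrite -pP; apply: propext.
  by split=> h t; [move=> _|]; apply: h; rewrite mem_enum.
elim: s => [|t s IH].
  exists (FImp FFalse FFalse) => v; apply: propext; split=> //=.
have [p pP] := definable_and (dR t) IH; exists p => v; rewrite -pP.
apply: propext; split=> [h|[h1 h2] x].
  by split=> [|x xs]; apply: h; rewrite inE ?eqxx// xs orbT.
by rewrite inE => /orP[/eqP->|/h2].
Qed.

Lemma definable_exists_one (V : Type) (R : set (option V -> M)) :
  definable R -> definable (fun v => exists c, R (scons c v)).
Proof.
move=> /definable_not[p pP]; have /definable_not[q qP] :
    definable (fun v => forall c, ~ R (scons c v)).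
  by exists (FAll p) => v /=; apply: eq_forall => c; rewrite -pP.
exists q => v; rewrite -qP; apply: propext; split=> [[c Rc] /(_ c)//|].
by move=> /existsNP[c /contrapT Rc]; exists c.
Qed.

Lemma definable_support (V : Type) (R : set (V -> M)) : definable R ->
  exists2 S : set V, finite_set S &
    forall v w, (forall x, S x -> v x = w x) -> R v = R w.
Proof.
case=> p pP; have [S fS SP] := sat_support p; exists S => // v w vw.
by rewrite !pP; exact: SP.
Qed.

Lemma definable_exists_ord n (X : Type) (R : set (X + 'I_n -> M)) :
  definable R -> definable (fun v => exists w : 'I_n -> M, R (join v w)).
Proof.
elim: n X R => [|n IH] X R dR.
  pose f (z : X + 'I_0) : X := match z with inl x => x
    | inr k => match notF (ltn_ord k) with end end.
  have [p pP] := definable_ren f dR; exists p => v; rewrite -pP.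
  have e w : v \o f = join v w by apply: funext => -[//|[]].
  apply: propext; split=> [[w Rw]|h]; first by rewrite (e w).
  by exists (fun k : 'I_0 => match notF (ltn_ord k) with end); rewrite -e.
pose f (z : X + 'I_n.+1) : option X + 'I_n := match z with
  | inl x => inl (Some x)
  | inr k => if unlift ord0 k is Some j then inr j else inl None end.
have [p pP] := definable_exists_one (IH _ _ (definable_ren f dR)).
exists p => v; rewrite -pP; apply: propext; split=> [[w Rw]|[c [w Rw]]].
  exists (w ord0), (w \o lift ord0).
  suff -> : join (scons (w ord0) v) (w \o lift ord0) \o f = join v w by [].
  apply: funext => -[//|k] /=; rewrite /f.
  by case: (unliftP ord0 k) => [j ->|->] /=; rewrite ?liftK ?unlift_none.
exists (fun k => if unlift ord0 k is Some j then w j else c).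
suff <- : join (scons c v) w \o f =
    join v (fun k => if unlift ord0 k is Some j then w j else c) by [].
apply: funext => -[//|k] /=; rewrite /f.
by case: (unlift ord0 k).
Qed.

(** Even if [Y] is infinite, [R] reads only finitely many coordinates of [w], so finitely many
    quantifiers suffice. *)
Lemma definable_exists (X Y : Type) (R : set (X + Y -> M)) :
  definable R -> definable (fun v => exists w : Y -> M, R (join v w)).
Proof.
move=> dR; have [S fS SP] := definable_support dR.
have fS' : finite_set (inr @^-1` S) by apply: finite_preimage => // x y _ _ [].
have [n [g [f fg]]] := finite_set_code fS'.
pose h (z : X + Y) : X + 'I_n :=
  match z with inl x => inl x | inr y => inr (g y) end.
have [p pP] := definable_exists_ord (definable_ren h dR); exists p => v.
rewrite -pP; apply: propext; split=> [[w Rw]|[w Rw]].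
  exists (w \o f).
  by rewrite (SP _ (join v w))// => -[//|y] /fg /= ->.
by exists (w \o g); rewrite (SP _ (join v w \o h))// => -[].
Qed.

End Definable.

(** * Expansions by unary predicates *)

Section Expansion.
Variables (L : language) (P : Type).
Local Notation L' := (unary_language L P).

Fixpoint tlift (V : Type) (t : term L V) : term L' V :=
  match t with
  | TVar x => @TVar L' V x
  | TApp g ts => @TApp L' V g (fun k => tlift (ts k))
  end.

Fixpoint flift (V : Type) (phi : formula L V) : formula L' V :=
  match phi with
  | FFalse => FFalse
  | FEq t u => FEq (tlift t) (tlift u)
  | FRel r ts => @FRel L' V (inl r) (fun k => tlift (ts k))
  | FImp p q => FImp (flift p) (flift q)
  | FAll p => FAll (flift p)
  end.

Variables (M : structure L) (U : P -> set M).
Local Notation M' := (unary_expansion U).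

Lemma teval_lift (V : Type) (v : V -> M) (t : term L V) :
  @teval L' M' V v (tlift t) = teval v t.
Proof. by elim: t => //= g ts IH; congr finterp; apply: funext. Qed.

Lemma sat_lift (V : Type) (phi : formula L V) :
  forall v : V -> M, @sat L' M' V v (flift phi) = sat v phi.
Proof.
elim: phi => {V} [V|V t u|V r ts|V p IHp q IHq|V p IHp] v //=.
- by rewrite !teval_lift.
- by congr rinterp; apply: funext => k; rewrite teval_lift.
- by rewrite IHp IHq.
- by apply: eq_forall => c; rewrite IHp.
Qed.

Lemma definable_lift (V : Type) (R : set (V -> M)) :
  definable R -> @definable L' M' V R.
Proof. by case=> p pP; exists (flift p) => v; rewrite sat_lift. Qed.

Lemma definable_pred (V : Type) (p : P) (x : V) :
  @definable L' M' V (fun v => U p (v x)).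
Proof. by exists (@FRel L' V (inr p) (fun=> @TVar L' V x)). Qed.

End Expansion.

Section MonadicNIP.
Variables (L : language) (T : theory L) (C : structure L).
Hypotheses (mnip : monadically_NIP T) (CT : model C T).

(** Finite supports turn [R] into a formula on finite tuples; if it shattered every [n], the
    expansion itself would witness its independence property. *)
Lemma expansion_not_shatter (P : Type) (U : P -> set C) (X Y : Type)
    (R : set (X + Y -> C)) :
  definable (M := unary_expansion U) R ->
  exists n, forall (x : 'I_n -> X -> C) (y : {set 'I_n} -> Y -> C),
    ~ forall i S, R (join (x i) (y S)) <-> i \in S.
Proof.
move=> dR; have [S fS SP] := definable_support dR.
have fl : finite_set (inl @^-1` S) by apply: finite_preimage => // ? ? _ _ [].
have fr : finite_set (inr @^-1` S) by apply: finite_preimage => // ? ? _ _ [].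
have [p [g [f fg]]] := finite_set_code fl.
have [q [g' [f' fg']]] := finite_set_code fr.
pose h (z : X + Y) : 'I_p + 'I_q :=
  match z with inl x => inl (g x) | inr y => inr (g' y) end.
have [phi phiP] := definable_ren h dR.
apply: contrapT => /forallNP sh; apply: (mnip CT (U := U) (phi := phi)) => n.
have /existsNP[x /existsNP[y /contrapT xyP]] := sh n.
exists (unary_expansion U) => //.
exists (fun i => x i \o f), (fun S => y S \o f').
move=> i Z; rewrite -phiP -xyP.
by rewrite (SP _ (join (x i) (y Z)))// => -[z /fg|z /fg'] /= ->.
Qed.

Lemma not_shatter (X Y : Type) (R : set (X + Y -> C)) : definable R ->
  exists n, forall (x : 'I_n -> X -> C) (y : {set 'I_n} -> Y -> C),
    ~ forall i S, R (join (x i) (y S)) <-> i \in S.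
Proof.
by move=> /(@definable_lift L void C (fun=> set0)); exact: expansion_not_shatter.
Qed.

(* Naming {c_{s,t} : (s,t) in E} by a unary predicate makes an arbitrary
   bipartite graph E on the tuples x_s, y_t definable. *)
Lemma no_tuple_coding (X Y : Type) (Q : set ((X + Y) + unit -> C)) :
  definable Q ->
  ~ exists (x : nat -> X -> C) (y : nat -> Y -> C) (c : nat -> nat -> C),
      forall s t u v,
        Q (join (join (x s) (y t)) (fun=> c u v)) <-> s = u /\ t = v.
Proof.
move=> dQ [x [y [c Qc]]].
(* Each finite set of numbers is the set of all [s] with [E s t], for a suitable [t]; so [E]
   shatters. *)
pose E (s t : nat) := s \in CodeSeq.decode t.
pose U (_ : unit) : set C := [set z | exists s t : nat, E s t /\ z = c s t].
have dR : definable (M := unary_expansion U)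
    (fun v : X + Y -> C => exists w : unit -> C, Q (join v w) /\ U tt (w tt)).
  apply: (@definable_exists _ (unary_expansion U) (X + Y) unit
    (fun v => Q v /\ U tt (v (inr tt)))).
  by apply: definable_and; [exact: definable_lift | exact: definable_pred].
have [n] := expansion_not_shatter dR.
move=> /(_ (fun i => x i)
  (fun S => y (CodeSeq.code [seq val i | i in S]))); apply => i S.
have EP : E i (CodeSeq.code [seq val i | i in S]) <-> i \in S.
  by rewrite /E CodeSeq.codeK fintype.mem_image//; exact: val_inj.
rewrite -EP; split=> [[w [Qw [s [t [Est wE]]]]]|Eit /=].
  have ew : w = (fun=> c s t) by apply: funext => -[].
  by move: Qw; rewrite ew => /Qc[-> ->].
exists (fun _ : unit => c i (CodeSeq.code [seq val i | i in S])); split.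
  by apply/Qc.
by exists i, (CodeSeq.code [seq val i | i in S]).
Qed.

End MonadicNIP.

Lemma small_countable (K : Type) (L : language) (X : countType) :
  small K (formula L nat) -> small K X.
Proof.
move=> [fK Kf].
have Xnat : [set: X] #<= [set: nat] by exact: countableP.
have natf : [set: nat] #<= [set: formula L nat].
  pose h n : formula L nat := FEq (@TVar L nat n) (@TVar L nat n).
  have hI : {in [set: nat] &, injective h} by move=> m n _ _ [].
  rewrite -(card_le_eql (inj_card_eq hI)).
  exact: subset_card_le.
split=> [|KX]; first exact: card_le_trans (card_le_trans Xnat natf) fK.
by apply: Kf; exact: card_le_trans KX (card_le_trans Xnat natf).
Qed.

(** * From finite codings to infinite ones by saturation *)

Section FiniteCoding.
Variables (L : language) (T : theory L) (K : Type) (C : structure L).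
Hypotheses (mnip : monadically_NIP T) (CT : model C T).
Hypotheses (Kbig : small K (formula L nat)) (satC : saturated K C).

Definition codes (X Y : Type) (Q : set ((X + Y) + unit -> C))
    (x : nat -> X -> C) (y : nat -> Y -> C) (c : nat -> nat -> C) s t u v :=
  Q (join (join (x s) (y t)) (fun=> c u v)) <-> s = u /\ t = v.

(** Compactness: a coding of the infinite grid is a type in countably many variables, finitely
    satisfiable by the finite codings and hence realized. *)
Lemma no_finite_tuple_coding (X Y : Type) (Q : set ((X + Y) + unit -> C)) :
  definable Q ->
  ~ forall m, exists x y c, forall s t u v,
      (s < m)%N -> (t < m)%N -> (u < m)%N -> (v < m)%N ->
      codes Q x y c s t u v.
Proof.
move=> dQ fin; have [S fS SP] := definable_support dQ.
(* [X] and [Y] may be too large for saturation, so each tuple is first cut down to the finitely many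
   coordinates that [Q] reads. *)
have fl : finite_set ((inl \o inl) @^-1` S).
  by apply: finite_preimage => // ? ? _ _ [].
have fr : finite_set ((inl \o inr) @^-1` S).
  by apply: finite_preimage => // ? ? _ _ [].
have [p [g [f fg]]] := finite_set_code fl.
have [q [g' [f' fg']]] := finite_set_code fr.
pose h (z : (X + Y) + unit) : ('I_p + 'I_q) + unit :=
  match z with
  | inl (inl x) => inl (inl (g x))
  | inl (inr y) => inl (inr (g' y))
  | inr tt => inr tt
  end.
have dQ' := definable_ren h dQ; have [phi phiP] := dQ'.
pose V : countType := ((nat * 'I_p + nat * 'I_q) + nat * nat)%type.
pose sel s t u v (z : ('I_p + 'I_q) + unit) : V + void :=
  match z with
  | inl (inl k) => inl (inl (inl (s, k)))
  | inl (inr k) => inl (inl (inr (t, k)))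
  | inr tt => inl (inr (u, v))
  end.
pose F (w : nat * nat * (nat * nat)) : formula L (V + void) :=
  let: (s, t, (u, v)) := w in
  let psi := fren (sel s t u v) phi in
  if (s == u) && (t == v) then psi else FImp psi FFalse.
have FP (v : V -> C) (e : void -> C) s t s' t' :
    sat (join v e) (F (s, t, (s', t'))) <->
    codes (fun w => Q (w \o h)) (fun s k => v (inl (inl (s, k))))
      (fun t k => v (inl (inr (t, k)))) (fun u w => v (inr (u, w))) s t s' t'.
  have -> : codes (fun w => Q (w \o h)) (fun s k => v (inl (inl (s, k))))
      (fun t k => v (inl (inr (t, k)))) (fun u w => v (inr (u, w))) s t s' t' =
      (sat (join v e) (fren (sel s t s' t') phi) <-> s = s' /\ t = t').
    rewrite /codes phiP sat_ren; congr iff; congr sat.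
    by apply: funext => -[[]|[]].
  rewrite /F; case: eqP => [->|ne]; last first.
    by split=> [h1|h1 /= /h1[]]//; split=> [/h1|[]].
  case: eqP => [->|ne]; last first.
    by split=> [h1|h1 /= /h1[]]//; split=> [/h1|[]].
  by split=> [h1|[_ h1]]; [split|exact: h1].
have [] := satC (small_countable V Kbig) (small_countable void Kbig)
  (e := of_void C) (p := range F).
  move=> G fG GF.
  have /choice[idx idxP] psi : exists w, G psi -> F w = psi.
    case: (pselect (G psi)) => [/GF[w _ <-]|nG]; first by exists w.
    by exists (0, 0, (0, 0))%N.
  have /finite_seqP[l lP] := finite_image idx fG.
  (* The sum of four indices bounds each of them, so one finite coding serves all the conditions in
     [G]. *)
  pose mx (w : nat * nat * (nat * nat)) :=
    (w.1.1 + w.1.2 + (w.2.1 + w.2.2))%N.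
  have [x [y [c xyc]]] := fin (\max_(w <- l) mx w).+1.
  exists (fun z : V => match z with
    | inl (inl (s, k)) => x s (f k)
    | inl (inr (t, k)) => y t (f' k)
    | inr (u, v) => c u v end) => psi Gpsi.
  have : idx psi \in l.
    have : [set` l] (idx psi) by rewrite -lP; exists psi.
    by [].
  move: (idxP _ Gpsi); case: (idx psi) => [[s t] [u v]] <- wl; apply/FP.
  have le : (mx (s, t, (u, v)) < (\max_(w <- l) mx w).+1)%N.
    by rewrite ltnS; exact: (@leq_bigmax_seq _ l xpredT mx _ wl isT).
  have := xyc s t u v; rewrite /codes => <-; last 4 first.
  - by apply: leq_trans le; rewrite ltnS /mx /= -!addnA leq_addr.
  - by apply: leq_trans le; rewrite ltnS /mx /= -addnA addnCA leq_addr.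
  - by apply: leq_trans le; rewrite ltnS /mx /= addnCA leq_addr.
  - by apply: leq_trans le; rewrite ltnS /mx /= addnA leq_addl.
  by rewrite (SP _ (join (join (x s) (y t)) (fun=> c u v)))// =>
    -[[z /fg|z /fg']|[]] //= ->.
move=> v vP; apply: (no_tuple_coding mnip CT dQ').
exists (fun s k => v (inl (inl (s, k)))), (fun t k => v (inl (inr (t, k)))),
  (fun u w => v (inr (u, w))) => s t s' t'.
by apply/FP; apply: vP; exists (s, t, (s', t')).
Qed.

End FiniteCoding.

(** * Breaks *)

(** [r] sends [w] to the rank of [u w], and [f] picks one [w] of each rank. This reduces tuples with
    repetitions, in any order, to the increasing ones that indiscernibility is about. *)
Lemma pattern_factor (d : Order.disp_t) (I : orderType d) (W : finType)
    (u v : W -> I) : (forall w w', (u w < u w')%O = (v w < v w')%O) ->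
  exists n (r : W -> 'I_n) (f : 'I_n -> W),
    [/\ increasing (u \o f), increasing (v \o f),
        u \o f \o r = u & v \o f \o r = v].
Proof.
move=> uv; have veq w w' : u w = u w' -> v w = v w'.
  move=> e; apply/eqP; rewrite eq_le !leNgt -!uv e !ltxx//.
pose l := sort <=%O (undup (codom u)).
have lS : sorted <%O l by rewrite sort_lt_sorted undup_uniq.
have lu w : u w \in l by rewrite mem_sort mem_undup codom_f.
have /choice[f fP] (k : 'I_(size l)) : exists w, u w = tnth (in_tuple l) k.
  have : tnth (in_tuple l) k \in codom u.
    by rewrite -mem_undup -(mem_sort <=%O) mem_tnth.
  by move=> /codomP[w ->]; exists w.
have lt w : (index (u w) l < size l)%N by rewrite index_mem.
pose r w := Ordinal (lt w).
have ur w : u (f (r w)) = u w.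
  by rewrite fP (tnth_nth (u w)) /= nth_index.
have uI : increasing (u \o f).
  move=> k m km; rewrite /= !fP !(tnth_nth (u (f k))).
  by apply: sorted_ltn_nth => //; [exact: lt_trans | exact: ltn_ord..].
exists (size l), r, f; split=> //.
- by move=> k m /uI; rewrite /= uv.
- exact: funext.
- by apply: funext => w; apply: veq.
Qed.

Section Moves.
Variables (L : language) (C : structure L) (A : Type) (d : Order.disp_t)
  (I : orderType d) (a : I -> A -> C).

Definition entry (W : Type) (u : W -> I) (z : W * A) : C := a (u z.1) z.2.

Lemma indiscernible_pattern (J : set I) (B : set C) (W : finType) (Y : Type)
    (R : set (W * A + Y -> C)) (e : Y -> C) (u v : W -> I) :
  indiscernible a J B -> definable R -> (forall y, B (e y)) ->
  (forall w, J (u w)) -> (forall w, J (v w)) ->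
  (forall w w', (u w < u w')%O = (v w < v w')%O) ->
  R (join (entry u) e) <-> R (join (entry v) e).
Proof.
move=> ind dR Be Ju Jv uv.
have [n [r [f [uI vI ur vr]]]] := pattern_factor uv.
have [S fS SP] := definable_support dR.
have fS' : finite_set (inr @^-1` S) by apply: finite_preimage => // ? ? _ _ [].
have [m [g [h gh]]] := finite_set_code fS'.
pose k (z : W * A + Y) : 'I_n * A + 'I_m :=
  match z with inl (w, x) => inl (r w, x) | inr y => inr (g y) end.
have [phi phiP] := definable_ren k dR.
have E t : t \o f \o r = t ->
    R (join (entry t) e) = sat (join (fun x => a ((t \o f) x.1) x.2) (e \o h)) phi.
  move=> tr; rewrite -phiP; apply: SP => -[[w x] _|y /gh /= ->//] /=.
  by rewrite /entry /= -{1}tr.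
by rewrite !E//; apply: ind => // i; [exact: Be|exact: Ju|exact: Jv].
Qed.

(** Coordinates whose two indices are in [J] stay variables; the entries of the others lie over [Z]
    and become parameters. *)
Lemma indiscernible_move (J Z : set I) (b : C) (W : finType)
    (R : set (W * A + unit -> C)) (u v : W -> I) :
  indiscernible a J ([set b] `|` entries a Z) -> definable R ->
  (forall w, (J (u w) /\ J (v w)) \/ (u w = v w /\ Z (u w))) ->
  (forall w w', (u w < u w')%O = (v w < v w')%O) ->
  R (join (entry u) (fun=> b)) <-> R (join (entry v) (fun=> b)).
Proof.
move=> ind dR uvJ uv.
pose P w := `[< J (u w) /\ J (v w) >].
pose W' : finType := {w : W | P w}.
pose k (z : W * A + unit) : W' * A + (W * A + unit) :=
  match z with
  | inl (w, x) => if insub w is Some w' then inl (w', x) else inr (inl (w, x))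
  | inr tt => inr (inr tt)
  end.
(* The value [b] at a coordinate with [P w] is a default that [k] never reads. *)
pose e (z : W * A + unit) : C :=
  match z with inl (w, x) => if P w then b else a (u w) x | inr _ => b end.
have Be y : ([set b] `|` entries a Z) (e y).
  case: y => [[w x]|_] /=; last by left.
  case: (boolP (P w)) => [_|/asboolP nP]; first by left.
  by have [//|[_ Zu]] := uvJ w; right; exists (u w) => //; exists x.
have E t : (forall w, ~~ P w -> t w = u w) ->
    R (join (entry t) (fun=> b)) =
    R (join (entry (t \o (val : W' -> W))) e \o k).
  move=> tu; congr R; apply: funext => -[[w x]|[]] //=.
  case: insubP => [w' _ <-//|nP] /=.
  by rewrite (negPf nP) /entry /= tu.
rewrite (E u)// (E v); last first.
  by move=> w /asboolP nP; have [//|[->]] := uvJ w.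
apply: (indiscernible_pattern ind (definable_ren k dR) Be) => [w|w|w w'].
- by have /asboolP[] := valP w.
- by have /asboolP[] := valP w.
- exact: uv.
Qed.

Variable b : C.

Definition moved (p q x y : I) : Prop :=
  (x = p /\ y = q) \/ (x = y /\ ((x < p)%O \/ (q < x)%O)).

(** Recording only the change from true to false suffices, since [R] may be negated. *)
Definition break (p q : I) : Prop :=
  (p < q)%O /\
  exists (W : finType) (R : set (W * A + unit -> C)) (u v : W -> I),
    [/\ definable R, forall w, moved p q (u w) (v w),
        R (join (entry u) (fun=> b)) & ~ R (join (entry v) (fun=> b))].

Lemma moved_lt (p q x y x' y' : I) : (p < q)%O ->
  moved p q x y -> moved p q x' y' -> (x < x')%O = (y < y')%O.
Proof.
move=> pq [[-> ->]|[<- [xp|qx]]] [[-> ->]|[<- [xp'|qx']]]; rewrite ?ltxx//.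
- by rewrite !ltNge !ltW// (lt_trans xp').
- by rewrite qx' (lt_trans pq).
- by rewrite xp (lt_trans xp).
- by rewrite !ltNge !ltW// (lt_trans pq).
Qed.

Lemma break_move (J Z : set I) (p q : I) :
  indiscernible a J ([set b] `|` entries a Z) -> J p -> J q ->
  (forall x, (x < p)%O \/ (q < x)%O -> J x \/ Z x) -> ~ break p q.
Proof.
move=> ind Jp Jq JZ [pq [W [R [u [v [dR mv Ru nRv]]]]]].
apply: nRv; apply: (proj1 (indiscernible_move ind dR _ _) Ru) => [w|w w'].
  by have [[-> ->]|[<- /JZ[]]] := mv w; [left|left|right].
exact: moved_lt (mv w) (mv w').
Qed.

(** If the moving index pauses at [j], the truth value changes before or after the pause. *)
Lemma break_split (p q j : I) : (p < j)%O -> (j < q)%O -> break p q ->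
  break p j \/ break j q.
Proof.
move=> pj jq [pq [W [R [u [v [dR mv Ru nRv]]]]]].
pose t w := if u w == p then j else u w.
have [Rt|nRt] := pselect (R (join (entry t) (fun=> b))).
  right; split=> //; exists W, R, t, v; split=> // w; rewrite /t.
  have [[-> ->]|[<- uw]] := mv w; first by rewrite eqxx; left.
  right; case: eqP uw => [->|_]; first by case; rewrite ?ltxx ?(lt_gtF pq).
  by split=> //; case: uw => uw; [left; exact: lt_trans pj | right].
left; split=> //; exists W, R, u, t; split=> // w; rewrite /t.
have [[-> _]|[_ uw]] := mv w; first by rewrite eqxx; left.
right; case: eqP uw => [->|_]; first by case; rewrite ?ltxx ?(lt_gtF pq).
by split=> //; case: uw => uw; [left | right; exact: lt_trans jq _].
Qed.

End Moves.

(** * Indiscernibility from the absence of breaks *)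

Section NoBreak.
Variables (L : language) (C : structure L) (A : Type) (d : Order.disp_t)
  (I : orderType d) (a : I -> A -> C) (b : C).

Lemma no_break_eq (p q : I) (W : finType) (R : set (W * A + unit -> C))
    (u v : W -> I) :
  (p < q)%O -> ~ break a b p q -> definable R ->
  (forall w, moved p q (u w) (v w)) ->
  R (join (entry a u) (fun=> b)) <-> R (join (entry a v) (fun=> b)).
Proof.
move=> pq nb dR mv; split=> h; apply: contrapT => h'; apply: nb; split=> //.
  by exists W, R, u, v.
exists W, (fun v => ~ R v), u, v; split=> //; first exact: definable_not.
Qed.

(** The indices move from [s] to [r] one at a time, the first one first: the interval from [r k] to
    [s k] then contains no other index of the hybrid tuple and none of [Z]. *)
Lemma no_break_shift (J Z : set I) n m (R : set ('I_n * A + 'I_m -> C))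
    (e : 'I_m -> C) (s r : 'I_n -> I) :
  (forall p q, J p -> J q -> ~ break a b p q) ->
  (forall x y z, J x -> J y -> Z z -> (z < x)%O \/ (y < z)%O) ->
  definable R -> (forall k, ([set b] `|` entries a Z) (e k)) ->
  increasing s -> increasing r -> (forall k, J (s k)) -> (forall k, J (r k)) ->
  (forall k l, (r k < s l)%O) ->
  R (join (entry a s) e) <-> R (join (entry a r) e).
Proof.
move=> nb sep dR Be sI rI Js Jr rs.
(* The only parameter of a break is [b], so entries over [Z] must join the tuple; [o l] locates
   [e l] among them, or is [None] if [e l] is [b]. *)
have /choice[o oP] l : exists o : option (I * A),
    if o is Some zx then Z zx.1 /\ a zx.1 zx.2 = e l else e l = b.
  by case: (Be l) => [->|[z Zz [x <-]]]; [exists None | exists (Some (z, x))].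
pose hyb k (j : 'I_n) := if (j < k)%N then r j else s j.
suff H k : (k <= n)%N ->
    R (join (entry a (hyb k)) e) <-> R (join (entry a s) e).
  rewrite -(H n)// (_ : hyb n = r)//.
  by apply: funext => j; rewrite /hyb ltn_ord.
elim: k => [_|k IH kn]; first by rewrite (_ : hyb 0 = s).
rewrite -(IH (ltnW kn)); pose k0 := Ordinal kn.
(* In the case [None] the position is never read by [ren]; the default [h k0] is one that satisfies
   [moved]. *)
pose pos (h : 'I_n -> I) (w : 'I_n + 'I_m) : I := match w with
  | inl j => h j
  | inr l => if o l is Some zx then zx.1 else h k0 end.
pose ren (w : 'I_n * A + 'I_m) : ('I_n + 'I_m)%type * A + unit := match w with
  | inl (j, x) => inl (inl j, x)
  | inr l => if o l is Some zx then inl (inr l, zx.2) else inr tt end.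
have E h : R (join (entry a h) e) =
    R (join (entry a (pos h)) (fun=> b) \o ren).
  congr R; apply: funext => -[[j x]//|l] /=; rewrite /ren.
  by move: (oP l); case El: (o l) => [[z x]|]//= [_ <-]; rewrite /entry /= El.
rewrite !E; apply: (no_break_eq (rs k0 k0) _ (definable_ren ren dR)).
  exact: nb.
have hk : moved (r k0) (s k0) (hyb k.+1 k0) (hyb k k0).
  by left; rewrite /hyb /= ltnSn ltnn.
move=> [j|l] /=; last first.
  move: (oP l); case: (o l) => [[z x] [Zz _]|_] //=; right; split=> //.
  exact: sep.
case: (ltngtP j k) => [jk|kj|/(@val_inj _ _ _ j k0)->//]; right; rewrite /hyb.
  by rewrite jk (ltn_trans jk)//; split=> //; left; apply: rI.
have -> : (j < k.+1)%N = false by rewrite ltnS leqNgt kj.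
have -> : (j < k)%N = false by rewrite ltnNge ltnW.
by split=> //; right; apply: sI.
Qed.

Lemma increasing_le n (s : 'I_n -> I) (i j : 'I_n) :
  increasing s -> (i <= j)%N -> (s i <= s j)%O.
Proof.
by move=> sI; rewrite leq_eqVlt => /orP[/eqP/val_inj->//|/sI/ltW].
Qed.

Lemma chain_below (J : set I) (i : I) n :
  (forall j, J j -> exists2 k, J k & (k < j)%O) -> J i ->
  exists r : 'I_n -> I, increasing r /\ forall k, J (r k) /\ (r k < i)%O.
Proof.
move=> nomin Ji.
have /choice[f fP] j : exists k, J j -> J k /\ (k < j)%O.
  have [/nomin[k Jk kj]|nJ] := pselect (J j); first by exists k.
  by exists j.
have Jf k : J (iter k f i) by elim: k => //= k IH; exact: (fP _ IH).1.
have fI k l : (k < l)%N -> (iter l f i < iter k f i)%O.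
  elim: l => // l IH; rewrite ltnS leq_eqVlt => /orP[/eqP->|kl] /=.
    exact: (fP _ (Jf l)).2.
  exact: lt_trans (fP _ (Jf l)).2 (IH kl).
(* The iterates descend, so [n - k] puts them in increasing order; it is positive, which keeps them
   all below [i]. *)
exists (fun k => iter (n - k) f i); split=> [k l kl|k].
  by apply: fI; rewrite ltn_sub2l.
by split=> //; apply: (fI 0); rewrite subn_gt0.
Qed.

Lemma chain_above (J : set I) (i : I) :
  (forall j, J j -> exists2 k, J k & (j < k)%O) -> J i ->
  exists r : nat -> I, (forall k l, (k < l)%N -> (r k < r l)%O) /\
    forall k, J (r k) /\ (i < r k)%O.
Proof.
move=> nomax Ji.
have /choice[f fP] j : exists k, J j -> J k /\ (j < k)%O.
  have [/nomax[k Jk kj]|nJ] := pselect (J j); first by exists k.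
  by exists j.
have Jf k : J (iter k f i) by elim: k => //= k IH; exact: (fP _ IH).1.
have fI k l : (k < l)%N -> (iter k f i < iter l f i)%O.
  elim: l => // l IH; rewrite ltnS leq_eqVlt => /orP[/eqP->|kl] /=.
    exact: (fP _ (Jf l)).2.
  exact: lt_trans (IH kl) (fP _ (Jf l)).2.
by exists (fun k => iter k.+1 f i); split=> [k l kl|k];
  [apply: fI | split; [exact: Jf | exact: (fI 0)]].
Qed.

(** Two tuples in [J] are compared with a third one below both or above both, which exists as [J]
    has no least or no greatest element. *)
Lemma indiscernible_no_break (J Z : set I) :
  (forall j, J j -> exists2 k, J k & (k < j)%O) \/
    (forall j, J j -> exists2 k, J k & (j < k)%O) ->
  (forall x y z, J x -> J y -> Z z -> (z < x)%O \/ (y < z)%O) ->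
  (forall p q, J p -> J q -> ~ break a b p q) ->
  indiscernible a J ([set b] `|` entries a Z).
Proof.
move=> ends sep nb [|n] m phi e Be s t sI tI Js Jt.
  by rewrite (_ : s = t)//; apply: funext => -[].
have dR : definable (fun v : _ -> C => sat v phi) by exists phi.
case: ends => ends.
  have Jm : J (Order.min (s ord0) (t ord0)) by case: leP.
  have [r [rI rP]] := chain_below n.+1 ends Jm.
  have H u : increasing u -> (forall k, J (u k)) ->
      (Order.min (s ord0) (t ord0) <= u ord0)%O ->
      sat (join (entry a u) e) phi <-> sat (join (entry a r) e) phi.
    move=> uI Ju mu; apply: (no_break_shift nb sep dR) => // [k|k l].
      exact: (rP k).1.
    apply: lt_le_trans (rP k).2 (le_trans mu _).
    exact: increasing_le.
  by rewrite (H s) ?(H t) ?ge_min ?lexx ?orbT.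
have Jm : J (Order.max (s ord_max) (t ord_max)) by case: leP.
have [r [rI rP]] := chain_above ends Jm.
have H u : increasing u -> (forall k, J (u k)) ->
    (u ord_max <= Order.max (s ord_max) (t ord_max))%O ->
    sat (join (entry a (fun k : 'I_n.+1 => r k)) e) phi <->
    sat (join (entry a u) e) phi.
  (* Here the auxiliary tuple [r] is the upper one of the two. *)
  move=> uI Ju mu; apply: (no_break_shift nb sep dR) => // [k l|k|k l].
  - exact: rI.
  - exact: (rP k).1.
  apply: le_lt_trans (le_trans _ mu) (rP l).2.
  by apply: increasing_le => //; exact: leq_ord.
by rewrite -(H s) -?(H t) ?le_max ?lexx ?orbT.
Qed.

End NoBreak.

(** * Bounded alternation from NIP *)

Section Alternation.
Variables (L : language) (T : theory L) (C : structure L).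
Hypotheses (mnip : monadically_NIP T) (CT : model C T).
Variables (A : Type) (d : Order.disp_t) (I : orderType d) (a : I -> A -> C).
Hypothesis (aind : indiscernible a setT set0).

Lemma indiscernible_pattern0 (W : finType) (R : set (W * A -> C))
    (u v : W -> I) : definable R ->
  (forall w w', (u w < u w')%O = (v w < v w')%O) ->
  R (entry a u) <-> R (entry a v).
Proof.
move=> dR uv; have dR' := definable_ren (@inl (W * A) void) dR.
exact: (indiscernible_pattern (e := of_void C) aind dR' _ _ _ uv).
Qed.

(* If R alternates often along the sequence over parameters w, then choosing
   from each alternation one of its two ends and moving the chosen indices to
   fixed ones shows that R shatters. *)
Lemma alternation_bound (Y : Type) (R : set (A + Y -> C)) : definable R ->
  exists N, forall (w : Y -> C) (p q : nat -> I),
    (forall k, (k < N)%N -> (p k < q k)%O) ->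
    (forall k l, (k < l)%N -> (l < N)%N -> (q k < p l)%O) ->
    ~ forall k, (k < N)%N -> R (join (a (p k)) w) /\ ~ R (join (a (q k)) w).
Proof.
move=> dR; apply: contrapT => /forallNP alt.
have [n] := not_shatter mnip CT dR.
have /existsNP[w /existsNP[p /existsNP[q /not_implyP[pq /not_implyP[qp]]]]] :=
  alt n.
move=> /contrapT hit sh.
pose ka (S : {set 'I_n}) (i : 'I_n) := if i \in S then p i else q i.
have pka S (i : 'I_n) : (p i <= ka S i)%O.
  by rewrite /ka; case: ifP => // _; apply: ltW; apply: pq.
have kaq S (i : 'I_n) : (ka S i <= q i)%O.
  by rewrite /ka; case: ifP => // _; apply: ltW; apply: pq.
have kaI S (i j : 'I_n) : (i < j)%N -> (ka S i < ka S j)%O.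
  move=> ij; apply: le_lt_trans (kaq S i) _; apply: lt_le_trans (pka S j).
  exact: qp.
have kaP S S' (i j : 'I_n) : (ka S i < ka S j)%O = (ka S' i < ka S' j)%O.
  case: (ltngtP i j) => [ij|ji|/val_inj->]; last by rewrite !ltxx.
    by rewrite !kaI.
  by rewrite (lt_gtF (kaI S _ _ ji)) (lt_gtF (kaI S' _ _ ji)).
pose ren (i : 'I_n) (z : A + Y) : 'I_n * A + Y :=
  match z with inl x => inl (i, x) | inr y => inr y end.
(* Realizing the pattern [S] by some parameter is a definable property of the tuple, so
   indiscernibility transfers it. *)
have dT (S : {set 'I_n}) : definable (fun v : 'I_n * A -> C => exists w : Y -> C,
    forall i, R (join v w \o ren i) <-> i \in S).
  apply: (@definable_exists _ _ _ _
    (fun v => forall i, R (v \o ren i) <-> i \in S)).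
  apply: definable_forall_fin => i; apply: definable_iff_bool.
  exact: definable_ren.
have E (u : 'I_n -> I) (w' : Y -> C) i :
    join (entry a u) w' \o ren i = join (a (u i)) w'.
  by apply: funext => -[].
pose S0 : {set 'I_n} := finset xpredT.
have /choice[y yP] (S : {set 'I_n}) : exists w : Y -> C,
    forall i, R (join (a (ka S0 i)) w) <-> i \in S.
  suff [w' w'P] : exists w : Y -> C,
      forall i, R (join (entry a (ka S0)) w \o ren i) <-> i \in S.
    by exists w' => i; rewrite -E.
  apply: (proj1 (indiscernible_pattern0 (u := ka S) (dT S) _)) => //.
  (* The given [w] realizes [S] on [ka S], since [R] holds at each [p i] and fails at each [q i]. *)
  exists w => i; rewrite E /ka.
  have [h1 h2] := hit i (ltn_ord i).
  by case: ifP => // _; split.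
by apply: (sh (fun i => a (ka S0 i)) y) => i S; exact: yP.
Qed.

(** With all indices but the moving one frozen as parameters, [N] copies of the break side by side
    make a relation in one tuple alternate [N] times. *)
Lemma break_hits_bound (W : finType) (R : set (W * A + unit -> C))
    (u v : W -> I) (p q : I) :
  (p < q)%O -> definable R -> (forall w, moved p q (u w) (v w)) ->
  exists N, forall (c : C) (ka : nat -> I -> I),
    (forall k, (k < N)%N -> (ka k p < ka k q)%O) ->
    (forall k l, (k < l)%N -> (l < N)%N -> (ka k q < ka l p)%O) ->
    (forall k w, (k < N)%N -> u w != p -> ka k (u w) = ka 0 (u w)) ->
    ~ forall k, (k < N)%N ->
        R (join (entry a (ka k \o u)) (fun=> c)) /\
        ~ R (join (entry a (ka k \o v)) (fun=> c)).
Proof.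
move=> pq dR mv.
pose ren (z : W * A + unit) : A + (W * A + unit) := match z with
  | inl (w, x) => if u w == p then inl x else inr (inl (w, x))
  | inr tt => inr (inr tt) end.
have [N NP] := alternation_bound (definable_ren ren dR).
exists N => c ka kpq kqp kside hit.
pose y := join (entry a (ka 0 \o u)) (fun _ : unit => c).
have [] := NP y (fun k => ka k p) (fun k => ka k q) kpq kqp => k kN.
suff [-> ->] : join (a (ka k p)) y \o ren =
      join (entry a (ka k \o u)) (fun=> c) /\
    join (a (ka k q)) y \o ren = join (entry a (ka k \o v)) (fun=> c).
  exact: hit.
split; apply: funext => -[[w x]|[]] //=; rewrite /entry /=.
  by case: eqP => [->//|/eqP up]; rewrite /= /y /= /entry /= (kside k).
case: (mv w) => [[-> ->]|[<- out]]; first by rewrite eqxx.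
case: eqP => [up|/eqP up]; last by rewrite /= /y /= /entry /= (kside k).
by case: out; rewrite up ?ltxx ?(lt_gtF pq).
Qed.

End Alternation.

(** * Any two breaks intersect *)

(** Lexicographic comparison in base [n]; [cell] writes its digits (zone, column, rank) in this
    way. *)
Lemma digit_lt n q r q' r' : (r < n)%N -> (r' < n)%N ->
  (q * n + r < q' * n + r')%N = (q < q')%N || ((q == q') && (r < r')%N).
Proof.
move=> rn r'n; case: (ltngtP q q') => [qq|qq|->] /=; last by rewrite ltn_add2l.
  apply: (@leq_trans (q.+1 * n)); first by rewrite mulSn addnC ltn_add2r.
  by apply: leq_trans (leq_addr _ _); rewrite leq_mul2r qq orbT.
apply/negbTE; rewrite -leqNgt; apply: (@leq_trans (q'.+1 * n)).
  by rewrite mulSn addnC leq_add2r ltnW.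
by apply: leq_trans (leq_addr _ _); rewrite leq_mul2r qq orbT.
Qed.

Lemma digit_eq n q r q' r' : (r < n)%N -> (r' < n)%N ->
  (q * n + r == q' * n + r')%N = (q == q') && (r == r').
Proof.
move=> rn r'n; have n0 : (0 < n)%N by exact: leq_ltn_trans rn.
apply/eqP/andP => [e|[/eqP-> /eqP->]//]; split; apply/eqP.
  by have := congr1 (divn^~ n) e; rewrite !divnMDl// !divn_small// !addn0.
by have := congr1 (modn^~ n) e; rewrite !modnMDl !modn_small.
Qed.

Lemma card_ord_chain n (H : {set 'I_n}) k : (k <= #|H|)%N ->
  exists f : nat -> nat, (forall i j, (i < j)%N -> (j < k)%N -> (f i < f j)%N) /\
    forall i, (i < k)%N -> exists2 r : 'I_n, r \in H & val r = f i.
Proof.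
move=> kH; pose l := sort leq [seq val r | r in H].
have ls : size l = #|H| by rewrite size_sort size_map -cardE.
have lS : sorted ltn l.
  rewrite ltn_sorted_uniq_leq sort_uniq (sort_sorted leq_total) andbT.
  by rewrite map_inj_uniq ?enum_uniq//; exact: val_inj.
exists (nth 0 l); split=> [i j ij jk|i ik].
  by apply: (sorted_ltn_nth ltn_trans) => //; rewrite inE ls;
    apply: leq_trans kH => //; exact: ltn_trans jk.
have /mapP[r rH ->] : nth 0 l i \in [seq val r | r in H].
  by rewrite -(mem_sort leq) mem_nth// ls (leq_trans ik).
by exists r => //; rewrite -mem_enum.
Qed.

(** The union of the [F s] has at most [m * K] elements. *)
Lemma exists_outside m K n (F : 'I_m -> {set 'I_n}) :
  (forall s, #|F s| <= K)%N -> (m * K < n)%N ->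
  exists r, forall s, r \notin F s.
Proof.
move=> FK mKn; apply: contrapT => /forallNP h.
suff : (n <= m * K)%N by rewrite leqNgt mKn.
have cov : (\bigcup_(s < m) F s)%SET = [set: 'I_n]%SET.
  apply/finset.setP => r; rewrite finset.in_setT; apply/finset.bigcupP.
  have /existsNP[s /negP] := h r; rewrite negbK => rF.
  by exists s.
have : (#|(\bigcup_(s < m) F s)%SET| <= \sum_(s < m) K)%N.
  apply: (@leq_trans (\sum_(s < m) #|F s|)); last exact: leq_sum.
  apply: (big_ind2 (fun (X : {set 'I_n}) k => #|X| <= k)%N) => //.
    by rewrite finset.cards0.
  move=> X k Y l Xk Yl; apply: leq_trans (leq_add Xk Yl).
  by rewrite finset.cardsU leq_subr.
by rewrite cov finset.cardsT card_ord sum_nat_const card_ord.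
Qed.

(** * The grid of copies of two disjoint breaks *)

Section Grid.
Variables (L : language) (T : theory L) (K : Type) (C : structure L).
Hypotheses (mnip : monadically_NIP T) (CT : model C T).
Hypotheses (Kbig : small K (formula L nat)) (satC : saturated K C).
Variables (A : Type) (d : Order.disp_t) (I : orderType d) (a : I -> A -> C).
Hypothesis (aind : indiscernible a setT set0).
Variable e : nat -> I.
Hypothesis (eI : forall k l, (k < l)%N -> (e k < e l)%O).
Variables (W1 W2 : finType) (R1 : set (W1 * A + unit -> C))
  (R2 : set (W2 * A + unit -> C)) (u1 v1 : W1 -> I) (u2 v2 : W2 -> I)
  (p1 q1 p2 q2 : I) (b : C).
Hypotheses (pq1 : (p1 < q1)%O) (qp : (q1 < p2)%O) (pq2 : (p2 < q2)%O).
Hypotheses (dR1 : definable R1) (dR2 : definable R2).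
Hypotheses (mv1 : forall w, moved p1 q1 (u1 w) (v1 w))
  (mv2 : forall w, moved p2 q2 (u2 w) (v2 w)).

Definition hit (ka : I -> I) (c : C) : Prop :=
  (R1 (join (entry a (ka \o u1)) (fun=> c)) /\
   ~ R1 (join (entry a (ka \o v1)) (fun=> c))) /\
  (R2 (join (entry a (ka \o u2)) (fun=> c)) /\
   ~ R2 (join (entry a (ka \o v2)) (fun=> c))).

Hypothesis hit_b : hit id b.

(** The coordinates of all four tuples together, so that hitting both breaks is a single relation to
    be moved by indiscernibility. *)
Definition gidx : finType := ((W1 + W1) + (W2 + W2))%type.
Definition gpos (g : gidx) : I :=
  match g with
  | inl (inl w) => u1 w | inl (inr w) => v1 w
  | inr (inl w) => u2 w | inr (inr w) => v2 w
  end.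

Definition gren (W : Type) (i : W -> gidx) (z : W * A + unit) :
    gidx * A + unit :=
  match z with inl (w, x) => inl (i w, x) | inr t => inr t end.

Definition hitv (v : gidx * A + unit -> C) : Prop :=
  (R1 (v \o gren (fun w => inl (inl w))) /\
   ~ R1 (v \o gren (fun w => inl (inr w)))) /\
  (R2 (v \o gren (fun w => inr (inl w))) /\
   ~ R2 (v \o gren (fun w => inr (inr w)))).

Lemma definable_hitv : definable hitv.
Proof.
apply: definable_and; apply: definable_and.
- exact: definable_ren.
- by apply: definable_not; exact: definable_ren.
- exact: definable_ren.
- by apply: definable_not; exact: definable_ren.
Qed.

Lemma hitE ka c : hit ka c = hitv (join (entry a (ka \o gpos)) (fun=> c)).
Proof.
have E (W : Type) (i : W -> gidx) :
    join (entry a (ka \o gpos)) (fun=> c) \o gren i =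
    join (entry a (ka \o gpos \o i)) (fun=> c).
  by apply: funext => -[[w x]|].
by rewrite /hitv !E.
Qed.

(** The values 1 and 3 stand for the intervals of the two breaks, and 0, 2, 4 for the gaps around
    them. *)
Definition zone (x : I) : nat :=
  ((p1 <= x)%O + (q1 < x)%O) + ((p2 <= x)%O + (q2 < x)%O).

Lemma zone_mono x y : (x <= y)%O -> (zone x <= zone y)%N.
Proof.
move=> xy; have H (c c' : bool) : (c -> c') -> (c <= c')%N.
  by case: c c' => [] [] // /(_ isT).
rewrite /zone; repeat apply: leq_add; apply: H => h.
- exact: le_trans xy.
- exact: lt_le_trans xy.
- exact: le_trans xy.
- exact: lt_le_trans xy.
Qed.

Lemma zone1 x : (zone x == 1) = (p1 <= x <= q1)%O.
Proof.
rewrite /zone; case: (leP p1 x) => [px|xp]; case: (leP x q1) => xq /=.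
- rewrite (lt_geF (le_lt_trans xq qp)).
  by rewrite (lt_gtF (le_lt_trans xq (lt_trans qp pq2))).
- by case: leP => //; case: leP.
- have xp2 := lt_trans xp (lt_trans pq1 qp).
  by rewrite (lt_geF xp2) (lt_gtF (lt_trans xp2 pq2)).
- by have := lt_trans xp (lt_trans pq1 xq); rewrite ltxx.
Qed.

Lemma zone3 x : (zone x == 3) = (p2 <= x <= q2)%O.
Proof.
rewrite /zone; case: (leP p2 x) => [px|xp] /=.
  by rewrite (lt_le_trans qp px) (ltW (lt_le_trans (lt_trans pq1 qp) px)); case: leP.
by rewrite (lt_gtF (lt_trans xp pq2)); case: leP => _; case: leP.
Qed.

Definition rk (x : I) : nat := #|[pred g | (gpos g < x)%O]|.

Lemma rk_lt x : (rk x < #|gidx|.+1)%N.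
Proof. by rewrite ltnS max_card. Qed.

Lemma rk_mono g x : (gpos g < x)%O = (rk (gpos g) < rk x)%N.
Proof.
apply/idP/idP => [gx|].
  apply: proper_card; apply/properP; split.
    by apply/fintype.subsetP => k; rewrite !inE => /lt_trans; exact.
  by exists g; rewrite !inE ?ltxx.
rewrite ltNge; apply: contraTT; rewrite -ltnNge ltnS negbK => xg.
apply: subset_leq_card; apply/fintype.subsetP => k; rewrite !inE => /lt_le_trans; exact.
Qed.

(** Outside of the two intervals there is a single copy, whence the digit 0. *)
Definition gcol s t z : nat := if z == 1 then s else if z == 3 then t else 0.

(* The copy of x in the (s, t) cell of an N x N grid: the parts of the index set
   within [p1, q1] and [p2, q2] are replicated N times each, in order. *)
Definition cell N s t (x : I) : I :=
  e ((zone x * N + gcol s t (zone x)) * #|gidx|.+1 + rk x).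

Lemma e_lt k l : (e k < e l)%O = (k < l)%N.
Proof.
case: (ltngtP k l) => [/eI//|/eI/lt_gtF//|->]; exact: ltxx.
Qed.

Lemma cell_lt N s t s' t' x y : (s < N)%N -> (t < N)%N -> (s' < N)%N ->
  (t' < N)%N ->
  (cell N s t x < cell N s' t' y)%O =
  ((zone x < zone y)%N || ((zone x == zone y) &&
      (gcol s t (zone x) < gcol s' t' (zone y))%N)) ||
  (((zone x == zone y) && (gcol s t (zone x) == gcol s' t' (zone y))) &&
   (rk x < rk y)%N).
Proof.
move=> sN tN s'N t'N.
have gN i j z : (i < N)%N -> (j < N)%N -> (gcol i j z < N)%N.
  by move=> iN jN; rewrite /gcol; do 2 case: ifP => // _; exact: leq_trans sN.
by rewrite e_lt digit_lt ?rk_lt// digit_lt ?gN// digit_eq ?gN.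
Qed.

(** Zones are monotone, and in a fixed cell the column depends only on the zone; so within a zone
    the rank decides. *)
Lemma cell_gpos N s t g x : (s < N)%N -> (t < N)%N ->
  (cell N s t (gpos g) < cell N s t x)%O = (gpos g < x)%O.
Proof.
move=> sN tN; rewrite cell_lt//; case: (ltgtP (gpos g) x) => [gx|xg|<-].
- have := zone_mono (ltW gx); rewrite leq_eqVlt => /orP[/eqP->|->//].
    by rewrite !eqxx !ltnn -rk_mono gx.
- have := zone_mono (ltW xg); rewrite leq_eqVlt => /orP[/eqP->|zz].
    by rewrite !eqxx !ltnn -rk_mono (lt_gtF xg).
  by rewrite (gtn_eqF zz) ltnNge ltnW.
- by rewrite !eqxx !ltnn.
Qed.

(** Being hit by some singleton is a definable property of the tuple, true of the original one by
    [b], and each cell has the same order type. *)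
Lemma exists_hit N s t : (s < N)%N -> (t < N)%N ->
  exists c, hit (cell N s t) c.
Proof.
move=> sN tN.
have dE := definable_exists definable_hitv.
have [c cP] : exists w : unit -> C, hitv (join (entry a (cell N s t \o gpos)) w).
  apply: (proj1 (indiscernible_pattern0 aind (u := gpos) dE _)) => [g g'|].
    by rewrite /= cell_gpos.
  by exists (fun=> b); have := hit_b; rewrite hitE.
exists (c tt); rewrite hitE (_ : (fun=> c tt) = c)//.
by apply: funext => -[].
Qed.

(** Otherwise [u1] and [v1] would coincide. Thus [p1] is a value of [gpos], as [cell_gpos]
    requires. *)
Lemma u1_p1 : exists w, u1 w = p1.
Proof.
apply: contrapT => /forallNP h; case: hit_b => -[h1 h2] _; apply: h2.
rewrite (_ : v1 = u1)//; apply: funext => w.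
by case: (mv1 w) => [[/h]|[]].
Qed.

Lemma u2_p2 : exists w, u2 w = p2.
Proof.
apply: contrapT => /forallNP h; case: hit_b => _ [h1 h2]; apply: h2.
rewrite (_ : v2 = u2)//; apply: funext => w.
by case: (mv2 w) => [[/h]|[]].
Qed.

(** Along a row, the indices outside of the first interval do not depend on the cell, so a single
    singleton breaks boundedly many copies. *)
Lemma row_bound : exists n, forall N c t (f : nat -> nat),
  (t < N)%N -> (forall k, (k < n)%N -> (f k < N)%N) ->
  (forall k l, (k < l)%N -> (l < n)%N -> (f k < f l)%N) ->
  ~ forall k, (k < n)%N -> hit (cell N (f k) t) c.
Proof.
have [n nP] := break_hits_bound mnip CT aind pq1 dR1 mv1; exists n.
have [w wp] := u1_p1; have zp : zone p1 == 1 by rewrite zone1 lexx ltW.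
have zq : zone q1 == 1 by rewrite zone1 lexx ltW.
move=> N c t f tN fN fI H; apply: (nP c (fun k => cell N (f k) t)).
- by move=> k /fN kN; rewrite -wp (cell_gpos (inl (inl w)))//= wp.
- move=> k l kl ln; rewrite cell_lt ?fN ?(ltn_trans kl)//.
  by rewrite (eqP zp) (eqP zq) /= fI// orbT.
- move=> k w' kn uw; have [[/eqP]|[_ out]] := mv1 w'; first by rewrite (negPf uw).
  have z1 : (zone (u1 w') == 1) = false.
    by apply: negbTE; rewrite zone1 negb_and -!ltNge; case: out => ->; rewrite ?orbT.
  by rewrite /cell /gcol z1.
- by move=> k kn; have [] := H k kn.
Qed.

Lemma col_bound : exists n, forall N c s (f : nat -> nat),
  (s < N)%N -> (forall k, (k < n)%N -> (f k < N)%N) ->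
  (forall k l, (k < l)%N -> (l < n)%N -> (f k < f l)%N) ->
  ~ forall k, (k < n)%N -> hit (cell N s (f k)) c.
Proof.
have [n nP] := break_hits_bound mnip CT aind pq2 dR2 mv2; exists n.
have [w wp] := u2_p2; have zp : zone p2 == 3 by rewrite zone3 lexx ltW.
have zq : zone q2 == 3 by rewrite zone3 lexx ltW.
move=> N c s f sN fN fI H; apply: (nP c (fun k => cell N s (f k))).
- by move=> k /fN kN; rewrite -wp (cell_gpos (inr (inl w)))//= wp.
- move=> k l kl ln; rewrite cell_lt ?fN ?(ltn_trans kl)//.
  by rewrite (eqP zp) (eqP zq) /= fI// orbT.
- move=> k w' kn uw; have [[/eqP]|[_ out]] := mv2 w'; first by rewrite (negPf uw).
  have z3 : (zone (u2 w') == 3) = false.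
    by apply: negbTE; rewrite zone3 negb_and -!ltNge; case: out => ->; rewrite ?orbT.
  by rewrite /cell /gcol z3.
- by move=> k kn; have [] := H k kn.
Qed.

(** Cut a large grid into blocks of width [B] and take a singleton hitting the corner of block
    [(s0, t0)]. Choosing in the other blocks first columns, then rows, that avoid its further hits
    yields a subgrid hit exactly once, with the order type of the [m] by [m] grid. *)
Lemma exact_cell m (s0 t0 : 'I_m) : exists c, forall s t : 'I_m,
  hit (cell m s t) c <-> (s == s0) && (t == t0).
Proof.
have [n1 row] := row_bound; have [n2 col] := col_bound.
(* [B] exceeds the bound [n1] for one row and the bound [m * n2] for [m] columns together. *)
pose B := (n1 + m * n2).+1; pose N := m * B.
have inN (s : 'I_m) r : (r < B)%N -> (s * B + r < N)%N.
  move=> rB; apply: (@leq_trans (s.+1 * B)).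
    by rewrite mulSn addnC ltn_add2r.
  by rewrite leq_mul2r ltn_ord orbT.
have inN0 (s : 'I_m) : (s * B < N)%N by rewrite -[X in (X < _)%N]addn0 inN.
have [c hc] := exists_hit (inN0 s0) (inN0 t0).
(* Choice of the columns: in row [t0 * B] the cells of a block cannot all be hit. *)
have /choice[f fP] (s : 'I_m) : exists r, (r < B)%N /\
    if s == s0 then r = 0 else ~ hit (cell N (s * B + r) (t0 * B)) c.
  case: eqP => [_|_]; first by exists 0.
  apply: contrapT => /forallNP h.
  apply: (row N c (t0 * B) (fun k => s * B + k)) => // k.
  - by move=> kn; apply: inN; rewrite ltnS (leq_trans (ltnW kn)) ?leq_addr.
  - by move=> l kl _; rewrite ltn_add2l.
  - move=> kn; apply: contrapT => nh; apply: (h k); split=> //.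
    by rewrite ltnS (leq_trans (ltnW kn)) ?leq_addr.
pose sg (s : 'I_m) := s * B + f s.
have sgN s : (sg s < N)%N by apply: inN; exact: (fP s).1.
have sg0 : sg s0 = s0 * B by have := (fP s0).2; rewrite eqxx /sg => ->; rewrite addn0.
(* Choice of the rows: each of the [m] chosen columns forbids at most [n2] offsets. *)
have /choice[f' f'P] (t : 'I_m) : exists r, (r < B)%N /\
    if t == t0 then r = 0 else forall s, ~ hit (cell N (sg s) (t * B + r)) c.
  case: eqP => [_|_]; first by exists 0.
  pose F (s : 'I_m) : {set 'I_B} :=
    finset (fun r : 'I_B => `[< hit (cell N (sg s) (t * B + r)) c >]).
  have FK s : (#|F s| <= n2)%N.
    rewrite leqNgt; apply/negP => /ltnW/card_ord_chain[g [gI gP]].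
    apply: (col N c (sg s) (fun k => t * B + g k)) => // k.
    - by move=> /gP[r _ <-]; apply: inN; exact: ltn_ord.
    - by move=> l kl ln; rewrite ltn_add2l gI.
    - by move=> /gP[r + <-]; rewrite inE => /asboolP.
  have [|r rP] := exists_outside FK (n := B); first by rewrite ltnS leq_addl.
  exists r; split=> // s h; have := rP s; rewrite inE => /negP; apply.
  exact/asboolP.
pose tg (t : 'I_m) := t * B + f' t.
have tgN t : (tg t < N)%N by apply: inN; exact: (f'P t).1.
have tg0 : tg t0 = t0 * B by have := (f'P t0).2; rewrite eqxx /tg => ->; rewrite addn0.
have exa s t : hit (cell N (sg s) (tg t)) c <-> (s == s0) && (t == t0).
  case: (eqVneq t t0) => [->|tt0]; rewrite ?andbF ?andbT.
    case: (eqVneq s s0) => [->|ss0]; first by rewrite sg0 tg0.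
    by have := (fP s).2; rewrite (negPf ss0) tg0.
  by split=> // h; have := (f'P t).2; rewrite (negPf tt0) => /(_ s) [].
pose ren (s t : 'I_m) (z : gidx * A + unit) :
    (('I_m * 'I_m) * gidx)%type * A + unit :=
  match z with inl (g, x) => inl ((s, t, g), x) | inr w => inr w end.
have dE : definable (fun v : ('I_m * 'I_m * gidx)%type * A -> C =>
    exists w : unit -> C, forall st : 'I_m * 'I_m,
      hitv (join v w \o ren st.1 st.2) <-> (st.1 == s0) && (st.2 == t0)).
  apply: (@definable_exists _ _ _ _ (fun v => forall st : 'I_m * 'I_m,
      hitv (v \o ren st.1 st.2) <-> (st.1 == s0) && (st.2 == t0))).
  apply: definable_forall_fin => st; apply: definable_iff_bool.
  exact: definable_ren definable_hitv.
(* All cells of the chosen subgrid, and all those of the [m] by [m] grid, are gathered in one tuple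
   each and compared by indiscernibility. *)
pose k1 (z : 'I_m * 'I_m * gidx) := cell N (sg z.1.1) (tg z.1.2) (gpos z.2).
pose k2 (z : 'I_m * 'I_m * gidx) := cell m z.1.1 z.1.2 (gpos z.2).
have E1 s t w : join (entry a k1) w \o ren s t =
    join (entry a (cell N (sg s) (tg t) \o gpos)) w.
  by apply: funext => -[[]|].
have E2 s t w : join (entry a k2) w \o ren s t =
    join (entry a (cell m s t \o gpos)) w.
  by apply: funext => -[[]|].
have mono (h : 'I_m -> nat) (s s' : 'I_m) : (forall s, h s < B)%N ->
    (s * B + h s < s' * B + h s')%N = (s < s')%N.
  move=> hB; rewrite digit_lt//; case: (ltngtP s s') => //= /val_inj->.
  exact: ltnn.
have colE (s t s' t' : 'I_m) z :
    (gcol (sg s) (tg t) z < gcol (sg s') (tg t') z)%N =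
    (gcol s t z < gcol s' t' z)%N.
  rewrite /gcol; case: ifP => _; first by rewrite mono// => k; exact: (fP k).1.
  by case: ifP => _ //; rewrite mono// => k; exact: (f'P k).1.
have [w wP] : exists w : unit -> C, forall st : 'I_m * 'I_m,
    hitv (join (entry a k2) w \o ren st.1 st.2) <-> (st.1 == s0) && (st.2 == t0).
  apply: (proj1 (indiscernible_pattern0 aind (u := k1) dE _)).
    move=> [[s t] g] [[s' t'] g']; rewrite /k1 /k2 !cell_lt ?sgN ?tgN//=.
    case: (eqVneq (zone (gpos g)) (zone (gpos g'))) => [->|//].
    by rewrite colE !eqn_leq !(leqNgt (gcol _ _ _)) !colE.
  by exists (fun=> c) => -[s t] /=; rewrite E1 -hitE; exact: exa.
exists (w tt) => s t; rewrite -(wP (s, t)) /= E2 hitE.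
by rewrite (_ : (fun=> w tt) = w)//; apply: funext => -[].
Qed.

Lemma grid_false : False.
Proof.
(* Indices of zone 1 depend only on [s] and the others not on [s], so a cell is assembled from a
   tuple for [s] and a tuple for [t]. *)
pose ren (z : gidx * A + unit) : (gidx * A + gidx * A) + unit := match z with
  | inl (g, x) => inl (if zone (gpos g) == 1 then inl (g, x) else inr (g, x))
  | inr w => inr w end.
apply: (no_finite_tuple_coding mnip CT Kbig satC (definable_ren ren definable_hitv)).
move=> m.
have /choice[c cP] (uv : nat * nat) : exists c,
    (uv.1 < m)%N -> (uv.2 < m)%N -> forall s t, (s < m)%N -> (t < m)%N ->
    hit (cell m s t) c <-> (s == uv.1) && (t == uv.2).
  have [um|um] := ltnP uv.1 m; last by exists b.
  have [vm|vm] := ltnP uv.2 m; last by exists b.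
  have [c cP] := exact_cell (Ordinal um) (Ordinal vm).
  by exists c => _ _ s t sm tm; exact: (cP (Ordinal sm) (Ordinal tm)).
exists (fun s => entry a (cell m s 0 \o gpos)),
  (fun t => entry a (cell m 0 t \o gpos)).
exists (fun u v => c (u, v)) => s t u v sm tm um vm; rewrite /codes.
set v0 := _ \o ren.
have -> : v0 = join (entry a (cell m s t \o gpos)) (fun=> c (u, v)).
  rewrite /v0; apply: funext => -[[g x]|] //=; rewrite /entry /cell /gcol /=.
  by case: ifP => /= z1; rewrite z1.
rewrite -hitE (cP (u, v))//=; split=> [/andP[/eqP-> /eqP->]//|[-> ->]].
by rewrite !eqxx.
Qed.

End Grid.

(** * Cuts and points separating the breaks *)

Section Shift.
Variables (d : Order.disp_t) (I : orderType d).
Hypothesis Iend : without_endpoints I.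

Lemma count_lt (F : seq I) (x y : I) : x \in F ->
  (count (fun z => z < x)%O F < count (fun z => z < y)%O F)%N = (x < y)%O.
Proof.
move=> xF; apply/idP/idP; last first.
  move=> xy; apply: (@leq_trans (count (predU (fun z => z < x)%O (pred1 x)) F)).
    have := count_predUI (fun z => z < x)%O (pred1 x) F.
    rewrite (@eq_count _ (predI _ _) pred0) ?count_pred0 ?addn0 => [->|z /=].
      by rewrite -addn1 leq_add2l -has_count has_pred1.
    by case: eqP => [->|]; rewrite ?ltxx ?andbF.
  by apply: sub_count => z /= /orP[/lt_trans|/eqP->]; [exact|].
apply: contraTT; rewrite -leNgt -leqNgt => yx.
by apply: sub_count => z /= /lt_le_trans; exact.
Qed.

(** The rank in [F] picks the place in a finite chain below [i], which exists as there is no least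
    element. Ranks run from 0 to [size F], whence the length of the chain. *)
Lemma shift_below (i : I) (F : seq I) : exists sh : I -> I,
  [/\ forall x, above i x -> sh x = x, forall x, ~ above i x -> below i (sh x)
    & {in F &, forall x y, (sh x < sh y)%O = (x < y)%O}].
Proof.
have nomin (j : I) : setT j -> exists2 k, setT k & (k < j)%O.
  by have [[k kj] _] := Iend j; exists k.
have [r [rI rP]] := chain_below (size F).+1 nomin (Logic.I : setT i).
pose rk x : 'I_(size F).+1 := inord (count (fun z => z < x)%O F).
have rkE x : rk x = count (fun z => z < x)%O F :> nat.
  by rewrite inordK// ltnS count_size.
have rrk x y : x \in F -> (x < y)%O -> (r (rk x) < r (rk y))%O.
  by move=> xF xy; apply: rI; rewrite !rkE count_lt.
exists (fun x => if (i < x)%O then x else r (rk x)); split=> [x /= ->//|x /negP ix|].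
  by rewrite (negPf ix); exact: (rP _).2.
have mono x y : x \in F -> (x < y)%O ->
    ((if (i < x)%O then x else r (rk x)) < (if (i < y)%O then y else r (rk y)))%O.
  move=> xF xy; case: ifP => ix; first by rewrite (lt_trans ix xy).
  by case: ifP => iy; [exact: lt_trans (rP _).2 iy | exact: rrk].
move=> x y xF yF; case: (ltgtP x y) => [|yx|->]; [exact: mono| |exact: ltxx].
by rewrite (lt_gtF (mono _ _ yF yx)).
Qed.

Lemma shift_above (i : I) (F : seq I) : exists sh : I -> I,
  [/\ forall x, below i x -> sh x = x, forall x, ~ below i x -> above i (sh x)
    & {in F &, forall x y, (sh x < sh y)%O = (x < y)%O}].
Proof.
have nomax (j : I) : setT j -> exists2 k, setT k & (j < k)%O.
  by have [_ [k jk]] := Iend j; exists k.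
have [r [rI rP]] := chain_above nomax (Logic.I : setT i).
pose rk x := count (fun z => z < x)%O F.
have rrk x y : x \in F -> (x < y)%O -> (r (rk x) < r (rk y))%O.
  by move=> xF xy; apply: rI; rewrite count_lt.
exists (fun x => if (x < i)%O then x else r (rk x)); split=> [x /= ->//|x /negP ix|].
  by rewrite (negPf ix); exact: (rP _).2.
have mono x y : x \in F -> (x < y)%O ->
    ((if (x < i)%O then x else r (rk x)) < (if (y < i)%O then y else r (rk y)))%O.
  move=> xF xy; case: (ltP y i) => iy; first by rewrite (lt_trans xy iy).
  by case: ifP => ix; [exact: lt_trans ix (rP _).2 | exact: rrk].
move=> x y xF yF; case: (ltgtP x y) => [|yx|->]; [exact: mono| |exact: ltxx].
by rewrite (lt_gtF (mono _ _ yF yx)).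
Qed.

End Shift.

(** * Mutual indiscernibility in terms of breaks *)

Section Mutual.
Variables (L : language) (C : structure L) (A : Type) (d : Order.disp_t)
  (I : orderType d) (a : I -> A -> C) (b : C).

Lemma indiscernible_subset (J : set I) (B B' : set C) :
  B `<=` B' -> indiscernible a J B' -> indiscernible a J B.
Proof. by move=> BB ind n m phi e Be; apply: ind => k; exact: BB. Qed.

(* The indices outside of J are first moved into Z: when J is above i and Z is
   below i, this removes an index equal to i. *)
Lemma shift_no_break (J Z : set I) (p q : I) :
  J p -> J q -> indiscernible a (~` J) ([set b] `|` entries a J) ->
  indiscernible a J ([set b] `|` entries a Z) ->
  (forall z, Z z -> ~ J z) ->
  (forall F : seq I, exists sh : I -> I,
    [/\ forall x, J x -> sh x = x, forall x, ~ J x -> Z (sh x)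
      & {in F &, forall x y, (sh x < sh y)%O = (x < y)%O}]) ->
  ~ break a b p q.
Proof.
move=> Jp Jq indN indJ ZJ shift [pq [W [R [u [v [dR mv Ru nRv]]]]]].
have [sh [shJ shZ shF]] := shift (codom u ++ codom v).
have sh_move (t : W -> I) : (forall w, t w \in codom u ++ codom v) ->
    R (join (entry a t) (fun=> b)) <-> R (join (entry a (sh \o t)) (fun=> b)).
  move=> tF; apply: (indiscernible_move indN dR) => [w|w w'] /=.
    have [Jt|nJt] := pselect (J (t w)); first by right; rewrite shJ.
    by left; split=> //; apply: ZJ; exact: shZ.
  by rewrite shF.
apply: nRv; apply/sh_move; first by move=> w; rewrite mem_cat codom_f orbT.
have {}Ru := (proj1 (sh_move u (fun w => _)) Ru).
apply: (proj1 (indiscernible_move indJ dR _ _) (Ru _)) => [w|w w'|w] /=.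
- have [[-> ->]|[<- _]] := mv w; first by left; rewrite !shJ.
  have [Ju|nJu] := pselect (J (u w)); first by left; rewrite !shJ.
  by right; split=> //; exact: shZ.
- by rewrite !shF ?mem_cat ?codom_f ?orbT//; exact: moved_lt (mv w) (mv w').
- by rewrite mem_cat codom_f.
Qed.

Lemma mutual_no_break (J0 J1 : set I) :
  (forall j, J0 j -> exists2 k, J0 k & (k < j)%O) ->
  (forall j, J1 j -> exists2 k, J1 k & (j < k)%O) ->
  (forall i j, J0 i -> J1 j -> (i < j)%O) ->
  (forall p q, J0 p -> J0 q -> ~ break a b p q) ->
  (forall p q, J1 p -> J1 q -> ~ break a b p q) ->
  mutually_indiscernible a J0 J1 [set b].
Proof.
move=> nomin nomax J01 nb0 nb1; split.
  apply: indiscernible_no_break => //; first by left.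
  by move=> x y z _ J0y J1z; right; exact: J01.
apply: indiscernible_no_break => //; first by right.
by move=> x y z J1x _ J0z; left; exact: J01.
Qed.

Hypothesis Iend : without_endpoints I.
Hypothesis meet : forall p q p' q', break a b p q -> break a b p' q' ->
  (p' <= q)%O.

(** Suppose that a break lies strictly on one side of [i]. As all breaks meet it, the rest of [I],
    including [i], contains none and is indiscernible over [b] and that side; [shift_no_break] then
    excludes the break. *)
Lemma mutual_sidesP (i : I) :
  mutually_indiscernible a (below i) (above i) [set b] <->
  forall p q, break a b p q -> (p <= i)%O /\ (i <= q)%O.
Proof.
split=> [[ind0 ind1] p q pqb|H].
  have pq : (p < q)%O by case: pqb.
  rewrite !leNgt; split; apply/negP => ip; have pqb0 := pqb.
    apply: (shift_no_break (J := above i) (Z := below i)) pqb => //.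
    - exact: lt_trans pq.
    - apply: indiscernible_no_break => [|x y z /negP ix /negP iy /= iz|].
      + left=> j /negP; rewrite -leNgt => ji; have [[k kj] _] := Iend j.
        by exists k => //; apply/negP; rewrite -leNgt ltW// (lt_le_trans kj).
      + by right; apply: le_lt_trans iz; rewrite leNgt.
      + move=> p' q' _ /negP; rewrite -leNgt => q'i /meet /(_ pqb0).
        by rewrite leNgt (le_lt_trans q'i).
    - by move=> z zi /= /(lt_trans zi); rewrite ltxx.
    - exact: shift_below.
  apply: (shift_no_break (J := below i) (Z := above i)) pqb => //.
  - exact: lt_trans ip.
  - apply: indiscernible_no_break => [|x y z /negP ix /negP iy /= iz|].
    + right=> j /negP; rewrite -leNgt => ij; have [_ [k jk]] := Iend j.
      by exists k => //; apply/negP; rewrite -leNgt ltW// (le_lt_trans ij).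
    + by left; apply: lt_le_trans iz _; rewrite leNgt.
    + move=> p' q' /negP; rewrite -leNgt => ip2 _ /(meet pqb0).
      by rewrite leNgt (lt_le_trans ip).
  - by move=> z zi /= /lt_trans /(_ zi); rewrite ltxx.
  - exact: shift_above.
apply: mutual_no_break.
- move=> j ji; have [[k kj] _] := Iend j.
  by exists k => //; exact: lt_trans ji.
- move=> j ij; have [_ [k jk]] := Iend j.
  by exists k => //; exact: lt_trans jk.
- by move=> x y; exact: lt_trans.
- by move=> p q _ qi /H[_]; rewrite leNgt qi.
- by move=> p q ip _ /H[]; rewrite leNgt ip.
Qed.

(** Neither open side contains a break, so each is indiscernible over [b] and the closed other side,
    to which [i] belongs. *)
Lemma mutual_side_point (i : I) :
  (forall p q, break a b p q -> (p <= i)%O /\ (i <= q)%O) ->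
  mutually_indiscernible a (below i) (above i)
    ([set b] `|` entries a [set i]).
Proof.
move=> H; split.
  apply: (@indiscernible_subset _ _
      ([set b] `|` entries a [set k | (i <= k)%O])).
    move=> c [[cb|[k -> [x <-]]]|[k ik [x <-]]]; [by left|right|right].
      by exists i; [exact: lexx | exists x].
    by exists k; [exact: ltW | exists x].
  apply: indiscernible_no_break => [|x y z _ yi iz|].
  - left=> j ji; have [[k kj] _] := Iend j.
    by exists k => //; exact: lt_trans ji.
  - by right; exact: lt_le_trans iz.
  - by move=> p q _ qi /H[_]; rewrite leNgt qi.
apply: (@indiscernible_subset _ _
    ([set b] `|` entries a [set k | (k <= i)%O])).
  move=> c [[cb|[k -> [x <-]]]|[k ik [x <-]]]; [by left|right|right].
    by exists i; [exact: lexx | exists x].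
  by exists k; [exact: ltW | exists x].
apply: indiscernible_no_break => [|x y z ix _ zi|].
- right=> j ij; have [_ [k jk]] := Iend j.
  by exists k => //; exact: lt_trans jk.
- by left; exact: le_lt_trans ix.
- by move=> p q ip _ /H[]; rewrite leNgt ip.
Qed.

(** The two parts cover [I], so indices outside of a break within one part are in that part or count
    as parameters, and [break_move] applies without any shift. *)
Lemma mutual_cutP (J0 J1 : set I) : cut J0 J1 ->
  mutually_indiscernible a J0 J1 [set b] <->
  forall p q, break a b p q -> J0 p /\ J1 q.
Proof.
move=> [_ _ J01 lt01].
have J01P x : J0 x \/ J1 x by have : (J0 `|` J1) x by rewrite J01.
split=> [[ind0 ind1] p q pqb|H].
  have pq : (p < q)%O by case: pqb.
  case: (J01P p) => Jp; case: (J01P q) => Jq.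
  - by case: (break_move ind0 Jp Jq (fun x _ => J01P x) pqb).
  - by [].
  - by have := lt_trans pq (lt01 _ _ Jq Jp); rewrite ltxx.
  - have J10P x : J1 x \/ J0 x by case: (J01P x); [right|left].
    by case: (break_move ind1 Jp Jq (fun x _ => J10P x) pqb).
apply: mutual_no_break => //.
- move=> j J0j; have [[k kj] _] := Iend j; exists k => //.
  by case: (J01P k) => // /(lt01 _ _ J0j) /(lt_trans kj); rewrite ltxx.
- move=> j J1j; have [_ [k jk]] := Iend j; exists k => //.
  by case: (J01P k) => // /lt01 /(_ J1j) /(lt_trans jk); rewrite ltxx.
- by move=> p q _ J0q /H[_ /(lt01 _ _ J0q)]; rewrite ltxx.
- by move=> p q J1p _ /H[/lt01 /(_ J1p)]; rewrite ltxx.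
Qed.

End Mutual.

(** * Order theory of pairwise intersecting breaks *)

Section Cuts.
Variables (d : Order.disp_t) (I : orderType d) (B : I -> I -> Prop).
Hypothesis Bsplit : forall p q j, (p < j)%O -> (j < q)%O -> B p q ->
  B p j \/ B j q.
Hypothesis Bmeet : forall p q p' q', B p q -> B p' q' -> (p' <= q)%O.
Hypothesis Bex : exists p q, B p q.

Definition separates (J0 J1 : set I) : Prop := forall p q, B p q -> J0 p /\ J1 q.
Definition pins (i : I) : Prop := forall p q, B p q -> (p <= i)%O /\ (i <= q)%O.

(** A point [j] of both [J0] and [J1'] would lie inside some break; splitting it at [j] gives a
    break that one of the cuts fails to separate. *)
Lemma separates_sub J0 J1 J0' J1' : cut J0 J1 -> cut J0' J1' ->
  separates J0 J1 -> separates J0' J1' -> J0 `<=` J0'.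
Proof.
move=> [_ _ _ lt01] [_ _ U' lt01'] s s' j J0j.
have [//|J1'j] : (J0' `|` J1') j by rewrite U'.
have [p [q Bpq]] := Bex; have [_ J1q] := s _ _ Bpq; have [J0'p _] := s' _ _ Bpq.
have [/s[_ J1j]|/s'[J0'j _]] := Bsplit (lt01' _ _ J0'p J1'j) (lt01 _ _ J0j J1q) Bpq.
  by have := lt01 _ _ J0j J1j; rewrite ltxx.
by have := lt01' _ _ J0'j J1'j; rewrite ltxx.
Qed.

Lemma cut_compl (J0 J1 : set I) : cut J0 J1 -> J1 = ~` J0.
Proof.
move=> [_ _ U lt01]; apply/seteqP; split=> j.
  by move=> J1j J0j; have := lt01 _ _ J0j J1j; rewrite ltxx.
by move=> nJ0; have [|//] : (J0 `|` J1) j by rewrite U.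
Qed.

Lemma separates_uniq J0 J1 J0' J1' : cut J0 J1 -> cut J0' J1' ->
  separates J0 J1 -> separates J0' J1' -> J0' = J0 /\ J1' = J1.
Proof.
move=> c c' s s'; have E : J0' = J0.
  by apply/seteqP; split; [exact: separates_sub c s' s | exact: separates_sub c' s s'].
by rewrite (cut_compl c) (cut_compl c') E.
Qed.

(** If [i] pins and some [j] in the same part lies between [i] and the cut, splitting a break at [j]
    gives one that misses [i] or stays within that part. *)
Lemma pins_separates J0 J1 i : cut J0 J1 -> separates J0 J1 ->
  pins i <-> is_maximal J0 i \/ is_minimal J1 i.
Proof.
move=> c s; have [_ _ U lt01] := c; have [p [q Bpq]] := Bex.
have [J0p J1q] := s _ _ Bpq; split=> [pi|[[J0i mx]|[J1i mn]] p' q' /s[J0p' J1q']].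
- have [J0i|J1i] : (J0 `|` J1) i by rewrite U.
    left; split=> // j J0j; rewrite leNgt; apply/negP => ij.
    have [pi' _] := pi _ _ Bpq.
    have [/s[_ J1j]|/pi[]] := Bsplit (le_lt_trans pi' ij) (lt01 _ _ J0j J1q) Bpq.
      by have := lt01 _ _ J0j J1j; rewrite ltxx.
    by rewrite leNgt ij.
  right; split=> // j J1j; rewrite leNgt; apply/negP => ji.
  have [_ iq] := pi _ _ Bpq.
  have [/pi[_]|/s[J0j _]] := Bsplit (lt01 _ _ J0p J1j) (lt_le_trans ji iq) Bpq.
    by rewrite leNgt ji.
  by have := lt01 _ _ J0j J1j; rewrite ltxx.
- by split; [exact: mx | exact: ltW (lt01 _ _ J0i J1q')].
- by split; [exact: ltW (lt01 _ _ J0p' J1i) | exact: mn].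
Qed.

Lemma exists_pin : ~ (exists J0 J1, cut J0 J1 /\ separates J0 J1) ->
  exists i, pins i.
Proof.
move=> nocut; apply: contrapT => /forallNP nopin; apply: nocut.
(* The initial segment generated by the left ends. If a right end [q] were in it, [q] would be at
   most some left end [p'], and [p'] would pin. *)
pose J0 : set I := [set x | exists p q, B p q /\ (x <= p)%O].
have sep p q : B p q -> J0 p /\ ~ J0 q.
  move=> Bpq; split; first by exists p, q.
  move=> [p' [q' [B' qp']]]; apply: (nopin p') => p2 q2 B2; split.
    have p2q := Bmeet Bpq B2; exact: le_trans qp'.
  exact: Bmeet B2 B'.
exists J0, (~` J0); split; last exact: sep.
have [p [q /sep[J0p J0q]]] := Bex.
split; [by exists p|by exists q|exact: setUv|].
move=> i j [p' [q' [B' ip']]] nJ0j; rewrite ltNge; apply/negP => ji.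
by apply: nJ0j; exists p', q'; split=> //; exact: le_trans ip'.
Qed.

(** Given two pins, the cut just after the smaller one separates. *)
Lemma pin_uniq i j : ~ (exists J0 J1, cut J0 J1 /\ separates J0 J1) ->
  pins i -> pins j -> j = i.
Proof.
move=> nocut; wlog ij : i j / (i < j)%O.
  move=> H pi pj; case: (ltgtP i j) => [ij|ji|//]; first exact: H.
  by apply/esym; apply: H.
move=> pi pj; case: nocut.
exists [set k | (k <= i)%O], [set k | (i < k)%O]; split.
  split.
  - by exists i; exact: lexx.
  - by exists j.
  - by apply/seteqP; split=> // k _ /=; case: (leP k i); [left|right].
  - by move=> x y; exact: le_lt_trans.
move=> p q Bpq; have [pi' _] := pi _ _ Bpq; have [_ jq] := pj _ _ Bpq.
by split=> //=; exact: lt_le_trans jq.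
Qed.

End Cuts.

Theorem proposition2p22 (L : language) (T : theory L) (K : Type)
    (C : structure L) (A : Type) (d : Order.disp_t) (I : orderType d)
    (a : I -> A -> C) (b : C) :
  complete T -> monadically_NIP T -> monster_model K T C ->
  small K I -> small K A ->
  without_endpoints I ->
  indiscernible a setT set0 ->
  ~ indiscernible a setT [set b] ->
  (exists I0 I1 : set I,
     [/\ cut I0 I1,
         mutually_indiscernible a I0 I1 [set b],
         forall J0 J1 : set I, cut J0 J1 ->
           mutually_indiscernible a J0 J1 [set b] -> J0 = I0 /\ J1 = I1
       & forall i : I,
           mutually_indiscernible a (below i) (above i) [set b] <->
           is_maximal I0 i \/ is_minimal I1 i])
  \/
  (exists i : I,
     [/\ mutually_indiscernible a (below i) (above i) [set b],
         forall j : I,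
           mutually_indiscernible a (below j) (above j) [set b] -> j = i
       & mutually_indiscernible a (below i) (above i)
           ([set b] `|` entries a [set i])]).
Proof.
move=> _ mnip [CT Kbig satC _] _ _ Iend aind nind.
have split_ p q j : (p < j)%O -> (j < q)%O -> break a b p q ->
    break a b p j \/ break a b j q by exact: break_split.
have ex : exists p q, break a b p q.
  apply: contrapT => nb; apply: nind.
  apply: (indiscernible_subset (B' := [set b] `|` entries a set0)).
    by move=> c; left.
  apply: indiscernible_no_break => // [|p q _ _ pqb].
    by left=> j _; have [[k kj] _] := Iend j; exists k.
  by apply: nb; exists p, q.
have meet p q p' q' : break a b p q -> break a b p' q' -> (p' <= q)%O.
  move=> [pq [W1 [R1 [u1 [v1 [dR1 mv1 Ru1 nRv1]]]]]].
  move=> [pq' [W2 [R2 [u2 [v2 [dR2 mv2 Ru2 nRv2]]]]]].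
  rewrite leNgt; apply/negP => qp'.
  have nomax (j : I) : setT j -> exists2 k, setT k & (j < k)%O.
    by have [_ [k jk]] := Iend j; exists k.
  (* Any infinite increasing sequence of indices can carry the grid. *)
  have [e [eI _]] := chain_above nomax (Logic.I : setT p).
  exact: (grid_false mnip CT Kbig satC aind eI pq qp' pq' dR1 dR2 mv1 mv2
    (conj (conj Ru1 nRv1) (conj Ru2 nRv2))).
have sidesP := mutual_sidesP Iend meet.
have cutP := @mutual_cutP _ _ _ _ _ a b Iend.
(* The two cases of the conclusion: the breaks are separated by a cut, or else a unique point pins
   them. *)
have [[I0 [I1 [c s]]]|nocut] :=
  pselect (exists J0 J1, cut J0 J1 /\ separates (break a b) J0 J1).
  left; exists I0, I1; split=> //.
  - exact/cutP.
  - by move=> J0 J1 c' /(cutP _ _ c'); exact: (separates_uniq split_ ex c c' s).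
  - by move=> i; rewrite sidesP; exact: (pins_separates split_ ex i c s).
have [i pi] := exists_pin meet ex nocut.
right; exists i; split.
- exact/sidesP.
- by move=> j /sidesP pj; exact: (pin_uniq nocut pi pj).
- exact: mutual_side_point.
Qed.
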